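(* Let $\mathcal{G}=(\Omega,E)$ be an arbitrary graph and let $\{\phi(u,v)\}_{(u,v)\in E}$ be a family of contractions on a Banach space $\mathcal{E}$ satisfying the identity axiom: $\phi(u,u)=\mathbf{I}$ for all $u\in\Omega$ with $(u,u)\in E$ (the divisibility axiom is not assumed). Then the following hold. (a) There exist a Banach space $\tilde{\mathcal{E}}$, a divisible dynamical system $\{U(u,v)\}_{(u,v)\in E}$ on the graph $\mathcal{G}$ consisting of surjective isometries on $\tilde{\mathcal{E}}$, a surjective (linear) contraction $j:\tilde{\mathcal{E}}\to\mathcal{E}$ and a linear isometry $r:\mathcal{E}\to\tilde{\mathcal{E}}$ with $j\circ r=\mathbf{I}$, such that $j\,U(u,v)\,r=\phi(u,v)$ for all $(u,v)\in E$. (b) Suppose $\mathcal{E}$ is a unital (resp. commutative unital) C$^*$-algebra $\mathcal{A}$ and $\phi=\{\Phi_{(u,v)}\}_{(u,v)\in E}$ is a family of positive unital linear operators on $\mathcal{A}$. Then there exist a unital (resp. commutative unital) C$^*$-algebra $\tilde{\mathcal{A}}$, a divisible dynamical system $\{U(u,v)\}_{(u,v)\in E}$ on the graph $\mathcal{G}$ consisting of ${}^*$-automorphisms of $\tilde{\mathcal{A}}$, a surjective unital ${}^*$-homomorphism $j:\tilde{\mathcal{A}}\to\mathcal{A}$ and an isometric positive unital linear map $r:\mathcal{A}\to\tilde{\mathcal{A}}$ with $j\circ r=\mathrm{id}_{\mathcal{A}}$, such that $j\,U(u,v)\,r=\Phi_{(u,v)}$ for all $(u,v)\in E$. (c) Suppose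 $\mathcal{E}$ is the space $L^{1}(\mathcal{H})$ of trace class operators on a Hilbert space $\mathcal{H}$ and $\phi=\{\Phi_{(u,v)}\}_{(u,v)\in E}$ is a family of CPTP-maps on $L^{1}(\mathcal{H})$. Then there exist an auxiliary Hilbert space $\tilde{\mathcal{H}}$, a divisible dynamical system $\{U(u,v)\}_{(u,v)\in E}$ on the graph $\mathcal{G}$ consisting of unitaries on $\mathcal{H}\otimes\tilde{\mathcal{H}}$, and a pure state $\omega\in L^{1}(\tilde{\mathcal{H}})$, such that $$\Phi_{(u,v)}(s)=\mathrm{tr}_{2}\big(U(u,v)\,(s\otimes\omega)\,U(u,v)^{*}\big)$$ for all $(u,v)\in E$ and $s\in L^{1}(\mathcal{H})$.
   Context: A graph $\mathcal{G}=(\Omega,E)$ consists of a non-empty set $\Omega$ of nodes and a non-empty set $E\subseteq\Omega\times\Omega$ of edges. A family $\{\psi(u,v)\}_{(u,v)\in E}$ of bounded operators on a Banach space is a divisible dynamical system on the graph $\mathcal{G}$ if it satisfies the identity axiom ($\psi(u,u)=\mathbf{I}$ for all $u\in\Omega$ with $(u,u)\in E$) and the divisibility axiom ($\psi(u,w)=\psi(u,v)\psi(v,w)$ for all $u,v,w\in\Omega$ with $(u,v),(v,w),(u,w)\in E$). $\mathbf{I}$ denotes the identity operator. A linear map $\Phi$ between C$^*$-algebras is positive if it maps positive elements to positive elements, and unital if $\Phi(1)=1$. A linear map $\Phi:L^1(H_1)\to L^1(H_2)$ is completely positive if $\Phi\otimes\mathrm{id}_n$ (with $\mathrm{id}_n$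 the identity on $M_n(\mathbb{C})$) is positive for every $n\in\mathbb{N}$; it is a CPTP-map (completely positive trace-preserving) if it is completely positive and $\mathrm{tr}(\Phi(s))=\mathrm{tr}(s)$ for all $s\in L^1(H_1)$. A pure state in $L^1(\tilde{\mathcal{H}})$ is an operator $|\eta\rangle\langle\eta|: x\mapsto\langle x,\eta\rangle\eta$ for a unit vector $\eta\in\tilde{\mathcal{H}}$. The partial trace $\mathrm{tr}_2:L^1(\mathcal{H}\otimes\tilde{\mathcal{H}})\to L^1(\mathcal{H})$ assigns to $s$ the unique $\mathrm{tr}_2(s)\in L^1(\mathcal{H})$ with $\mathrm{tr}(T\,\mathrm{tr}_2(s))=\mathrm{tr}((T\otimes\mathbf{I})s)$ for all bounded operators $T$ on $\mathcal{H}$. *)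

(* Defs.v *)
From HB Require Import structures.
From mathcomp Require Import all_boot all_order all_algebra finmap.
From mathcomp Require Import sesquilinear complex.
From mathcomp Require Import boolp classical_sets reals topology normedtype.
From mathcomp Require Import summability.

Set Implicit Arguments.
Unset Strict Implicit.
Unset Printing Implicit Defensive.
Import Order.TTheory GRing.Theory Num.Theory.
Import numFieldNormedType.Exports.
Local Open Scope classical_set_scope.
Local Open Scope ring_scope.

(* R[i] is kept packed as a numClosedFieldType: the bare type R[i] would be
   given its structure of module over R rather than over itself. *)
Definition Cplx (R : realType) : numClosedFieldType := R[i]%C.

Variant banach_scalars (R : realType) : numFieldType -> Prop :=
  | RealScalars : banach_scalars R R
  | ComplexScalars : banach_scalars R (Cplx R).

Section BanachOperators.
Context {K : numFieldType}.
Implicit Types V W : normedModType K.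

Definition bounded_operator V W (T : V -> W) :=
  linear T /\ exists M, forall x, `|T x| <= M * `|x|.

Definition linear_contraction V W (T : V -> W) :=
  linear T /\ forall x, `|T x| <= `|x|.

Definition linear_isometry V W (T : V -> W) :=
  linear T /\ forall x, `|T x| = `|x|.

End BanachOperators.

Definition surjective (X Y : Type) (f : X -> Y) := forall y, exists x, f x = y.

Section Graphs.
Context {Om : Type} (E : set (Om * Om)).

Definition identity_axiom (X : Type) (psi : Om -> Om -> X -> X) :=
  forall u, E (u, u) -> psi u u = id.

Definition divisibility_axiom (X : Type) (psi : Om -> Om -> X -> X) :=
  forall u v w, E (u, v) -> E (v, w) -> E (u, w) ->
    psi u w = psi u v \o psi v w.

Definition divisible_system (K : numFieldType) (V : completeNormedModType K)
    (psi : Om -> Om -> V -> V) :=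
  [/\ forall u v, E (u, v) -> bounded_operator (psi u v),
      identity_axiom psi & divisibility_axiom psi].

End Graphs.

(* Unital C*-algebras.  The product is a field of the mixin and not that of a
   GRing.Algebra because Hierarchy Builder refuses a structure that inherits
   from both normed modules and rings: Num.NumDomain already does. *)
HB.mixin Record isCStarAlgebra (R : realType) (A : Type)
    of CompleteNormedModule (Cplx R) A := {
  cmul : A -> A -> A;
  cone : A;
  star : A -> A;
  cmulA : associative cmul;
  cmul1x : left_id cone cmul;
  cmulx1 : right_id cone cmul;
  cmulDl : left_distributive cmul +%R;
  cmulDr : right_distributive cmul +%R;
  cscaleAl : forall (a : Cplx R) x y, a *: cmul x y = cmul (a *: x) y;
  cscaleAr : forall (a : Cplx R) x y, a *: cmul x y = cmul x (a *: y);
  starK : involutive star;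
  starD : {morph star : x y / x + y};
  starZ : forall (a : Cplx R) x, star (a *: x) = Num.conj a *: star x;
  starM : forall x y, star (cmul x y) = cmul (star y) (star x);
  norm_cmul : forall x y : A, `|cmul x y| <= `|x| * `|y|;
  norm_star_cmul : forall x : A, `|cmul (star x) x| = `|x| ^+ 2
}.

#[short(type="cstarAlgType")]
HB.structure Definition CStarAlgebra (R : realType) :=
  {A of CompleteNormedModule (Cplx R) A & isCStarAlgebra R A}.

Section CStarMaps.
Context {R : realType}.
Implicit Types A B : cstarAlgType R.

Definition cstar_commutative A := commutative (@cmul R A).

Definition cstar_pos A (a : A) := exists b : A, a = cmul (star b) b.

Definition positive_map A B (f : A -> B) :=
  linear f /\ forall a, cstar_pos a -> cstar_pos (f a).

Definition unital_map A B (f : A -> B) := f (@cone R A) = cone.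

Definition unital_star_hom A B (f : A -> B) :=
  [/\ linear f, unital_map f, {morph f : x y / cmul x y} &
      {morph f : x / star x}].

Definition star_automorphism A (f : A -> A) :=
  unital_star_hom f /\ bijective f.

End CStarMaps.

HB.mixin Record isHilbert (R : realType) (H : Type)
    of CompleteNormedModule (Cplx R) H := {
  inner_subdef : {dot H for (@Num.conj (Cplx R))};
  normsqE_subproof : forall x : H, `|x| ^+ 2 = inner_subdef x x
}.

#[short(type="hilbertType")]
HB.structure Definition Hilbert (R : realType) :=
  {H of CompleteNormedModule (Cplx R) H & isHilbert R H}.

Definition inner {R : realType} {H : hilbertType R} :
  {dot H for (@Num.conj (Cplx R))} := inner_subdef.

Notation "'<|' x , y '|>'" := (inner x y)
  (at level 0, x at level 99, y at level 99, format "'<|' x ,  y '|>'")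
  : ring_scope.

Section HilbertOperators.
Context {R : realType}.
Implicit Types H : hilbertType R.

Lemma normsqE H (x : H) : `|x| ^+ 2 = <|x, x|>.
Proof. exact: normsqE_subproof. Qed.

(* In adjoint, abs_op, op_tens and ptrace2, xget names the element of a set
   that is a singleton for the arguments of interest (for adjoint: when T is
   bounded, by the Riesz theorem). *)
Definition adjoint H1 H2 (T : H1 -> H2) (y : H2) : H1 :=
  xget 0 [set z | forall x, <|T x, y|> = <|x, z|>].

Definition unitary H (U : H -> H) :=
  [/\ bounded_operator U, adjoint U \o U = id & U \o adjoint U = id].

Definition positive_op H (T : H -> H) :=
  bounded_operator T /\ forall x, 0 <= <|T x, x|>.

Definition orthonormal_set H (B : set H) :=
  (forall e, B e -> <|e, e|> = 1) /\
  (forall e f, B e -> B f -> e <> f -> <|e, f|> = 0).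

Definition orthonormal_basis H (B : set H) :=
  orthonormal_set B /\ forall x, (forall e, B e -> <|x, e|> = 0) -> x = 0.

Lemma orthonormal_basis_exists H : exists B : set H, orthonormal_basis B.
Proof.
have [|B [[B1 Bo] Bmax]] := @Zorn_bigcup _ (@orthonormal_set H).
  move=> F FP tot; split=> [e [X FX Xe]|e f [X FX Xe] [Y FY Yf] ef].
    exact: (FP _ FX).1.
  by case: (tot _ _ FX FY) => XY;
    [apply: (FP _ FY).2 => //; exact: XY|apply: (FP _ FX).2 => //; exact: XY].
exists B; split=> // x xB; apply: contrapT => /eqP x0.
have nx : `|x| != 0 :> Cplx R by rewrite normr_eq0.
pose e := `|x|^-1 *: x.
have eB f : B f -> <|e, f|> = 0.
  by move=> Bf; rewrite /e linearZl_LR /= (xB _ Bf) mulr0.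
have e1 : <|e, e|> = 1.
  by rewrite -normsqE normrZ normfV normr_id mulVf // expr1n.
have nBe : ~ B e by move=> /eB; rewrite e1 => /eqP; rewrite oner_eq0.
apply: (Bmax (B `|` [set e])).
  split; first by move=> f Bf; left.
  by move=> h; apply: nBe; apply: h; right.
have Be f : B f -> <|f, e|> = 0.
  by move=> Bf; rewrite hermC /= eB // conjC0 mulr0.
split=> [f [/B1//|->//]|f g [Bf|->] [Bg|->] fg] //; first exact: Bo.
- exact: Be.
- exact: eB.
Qed.

(* A fixed orthonormal basis; traces do not depend on the choice. *)
Definition onb H : set H := xget set0 (@orthonormal_basis H).
Arguments onb H : clear implicits.

Lemma onbP H : orthonormal_basis (onb H).
Proof. by have [B hB] := orthonormal_basis_exists H; exact: (xgetI _ hB). Qed.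

Definition diag H (T : H -> H) (e : H) : Cplx R :=
  if e \in onb H then <|T e, e|> else 0.

(* The sum is the limit along the directed set of finite subsets of H. *)
Definition trace H (T : H -> H) : Cplx R := summability.sum (diag T).

(* P = |T|, the positive square root of T^* T. *)
Definition is_abs H (T P : H -> H) :=
  positive_op P /\ P \o P = adjoint T \o T.

(* tr |T| < +oo: the sum has nonnegative terms, so that it converges if and only
   if its partial sums are bounded. *)
Definition trace_class H (T : H -> H) :=
  bounded_operator T /\
  exists2 P, is_abs T P & exists M, forall A, partial_sum (diag P) A <= M.

Definition abs_op H (T : H -> H) : H -> H := xget (fun=> 0) (is_abs T).

Definition trace_norm H (T : H -> H) := trace (abs_op T).

Definition pure_state H (w : H -> H) :=
  exists2 eta : H, `|eta| = 1 & w = fun x => <|x, eta|> *: eta.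

(* Positivity of the operator matrix (s i j) acting on H ^ n, i.e. of the
   element \sum_(i, j) s i j (x) E_ij of L^1(H) (x) M_n(C).  The map Phi (x) id_n
   applies Phi to every entry. *)
Definition positive_opmx H n (s : 'I_n -> 'I_n -> H -> H) :=
  forall x : 'I_n -> H, 0 <= \sum_(i < n) \sum_(j < n) <|s i j (x j), x i|>.

(* A map L^1(H1) -> L^1(H2) is represented by a map on all functions, of which
   only the values on trace class operators matter. *)
Definition trace_class_linear H1 H2 (Phi : (H1 -> H1) -> H2 -> H2) :=
  (forall s, trace_class s -> trace_class (Phi s)) /\
  (forall (a : Cplx R) s t, trace_class s -> trace_class t ->
     Phi (fun x => a *: s x + t x) = fun x => a *: Phi s x + Phi t x).

Definition completely_positive H1 H2 (Phi : (H1 -> H1) -> H2 -> H2) :=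
  forall n (s : 'I_n -> 'I_n -> H1 -> H1),
    (forall i j, trace_class (s i j)) ->
    positive_opmx s -> positive_opmx (fun i j => Phi (s i j)).

Definition trace_preserving H1 H2 (Phi : (H1 -> H1) -> H2 -> H2) :=
  forall s, trace_class s -> trace (Phi s) = trace s.

Definition cptp H1 H2 (Phi : (H1 -> H1) -> H2 -> H2) :=
  [/\ trace_class_linear Phi, completely_positive Phi & trace_preserving Phi].

Definition trace_norm_contraction H1 H2 (Phi : (H1 -> H1) -> H2 -> H2) :=
  trace_class_linear Phi /\
  forall s, trace_class s -> trace_norm (Phi s) <= trace_norm s.

End HilbertOperators.
Arguments onb {R} H.

(* The Hilbert space tensor product, which is determined by these properties
   up to a unique unitary compatible with tens. *)
Record hilbert_tensor (R : realType) (H1 H2 : hilbertType R) := HilbertTensor {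
  tens_space :> hilbertType R;
  tens : {bilinear H1 -> H2 -> tens_space};
  inner_tens : forall x x' y y',
    <|tens x y, tens x' y'|> = <|x, x'|> * <|y, y'|>;
  tens_dense : forall z (eps : Cplx R), 0 < eps ->
    exists n (x : 'I_n -> H1) (y : 'I_n -> H2),
      `|z - \sum_(i < n) tens (x i) (y i)| < eps
}.

Section TensorOperators.
Context {R : realType} {H1 H2 : hilbertType R} (HT : hilbert_tensor H1 H2).

(* The operator S (x) T. *)
Definition op_tens (S : H1 -> H1) (T : H2 -> H2) : HT -> HT :=
  xget (fun=> 0) [set Q | bounded_operator Q /\
                          forall x y, Q (tens HT x y) = tens HT (S x) (T y)].

Definition ptrace2 (s : HT -> HT) : H1 -> H1 :=
  xget (fun=> 0) [set t | trace_class t /\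
    forall T : H1 -> H1, bounded_operator T ->
      trace (T \o t) = trace (op_tens T id \o s)].

End TensorOperators.
Arguments op_tens {R H1 H2} HT S T.
Arguments ptrace2 {R H1 H2} HT s.

(* Main.v *)
Require Import Defs.
From HB Require Import structures.
From mathcomp Require Import all_boot all_order all_algebra finmap.
From mathcomp Require Import sesquilinear complex.
From mathcomp Require Import boolp classical_sets functions reals topology normedtype.
From mathcomp Require Import summability.
From mathcomp Require Import ring.
Import Order.TTheory GRing.Theory Num.Theory.
Import numFieldNormedType.Exports.
Local Open Scope classical_set_scope.
Local Open Scope ring_scope.

(** Divisibility only relates edges that compose, so it can be made automatic
    by sending edges into a group.  Let G be the abelian group of integer
    functions on the nodes, and send (u, v) to d_u - d_v, where d_u is the
    indicator function of u.  Then (u, v) and (v, w) add up to (u, w), loops go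
    to 0, and distinct edges that are not loops go to distinct nonzero elements.
    Hence any family indexed by the edges which is trivial on loops extends to a
    family psi indexed by G with psi 0 trivial, without any compatibility
    condition ([edge_extension]), and it suffices to dilate psi to a
    representation of G.

    For contractions, G acts by translations on the bounded functions from G to
    the given space; r sends x to its orbit g |-> psi g x, j is evaluation at 0,
    and j U_g r x = (r x)(g) = psi g x.  Over a C*-algebra the same functions
    form a C*-algebra for the pointwise operations, translations are
    automorphisms, and an orbit of a positive element is positive because it is
    positive at every point with square roots that are uniformly bounded.

    For CPTP maps, each Phi_g has a Kraus family A_g, that is an isometry
    V_g x = (A_{g,s} x)_s into l2(S; H), which is the tensor product of H with
    l2(S), such that Phi_g(t) is the partial trace of V_g t V_g^*.  Giving every
    g its own copy of S makes the ranges of the V_g pairwise orthogonal, so that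
    D xi = sum_g V_g xi_g is an isometry of l2(G; H) into l2(G x S; H).  With T_g
    the shift of l2(G; H), the operators U_g = 1 - D D^* + D T_g D^* form a
    unitary representation of G with U_g V_0 = V_g, and V_0 is x |-> x (x) eta
    for a coordinate vector eta.

    Kraus families come from the kernel <Phi(|x><y|) a, b> on pairs of vectors,
    which is positive because Phi is completely positive: a maximal family of
    functions dominated by a positive kernel exhausts it
    ([kernel_decomposition]).  The trace identity that defines the partial trace
    is then known on operators of rank one.  It extends to all trace class
    operators t by Cholesky elimination on P = |t|: subtracting the rank-one
    operator |t y><P y| / <P y, y> from t subtracts |P y><P y| / <P y, y> from P,
    keeps P positive, and preserves |t x| = |P x| for every x.  Finitely many
    steps make P vanish on a finite part of an orthonormal basis that carries
    almost all its trace ([trace_class_density]).  The same elimination bounds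
    tr(B t) by the norm of B times the trace norm of t ([trace_bound]). *)

Set Implicit Arguments.
Unset Strict Implicit.
Unset Printing Implicit Defensive.

(** * Suprema of sets of nonnegative scalars *)

Definition is_lub (K : numFieldType) (S : set K) (l : K) :=
  (forall x, S x -> x <= l) /\ (forall m, (forall x, S x -> x <= m) -> l <= m).

(** This is the only property of the scalars on which the norms below depend;
    it is stated for partially ordered fields in order to cover the real and
    the complex scalars at once. *)
Definition lub_scalars (K : numFieldType) :=
  forall S : set K, S !=set0 -> (forall x, S x -> 0 <= x) ->
    (exists M, forall x, S x -> x <= M) -> exists l, is_lub S l.

Lemma real_lub (R : realType) : lub_scalars R.
Proof.
move=> S S0 _ [M SM]; have hS : has_sup S by split=> //; exists M.
exists (sup S); split; first exact: sup_upper_bound.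
by move=> m Sm; apply: ge_sup.
Qed.

(** Nonnegative complex numbers are real, so the supremum is that of the real
    parts. *)
Lemma complex_lub (R : realType) : lub_scalars (Cplx R).
Proof.
move=> S [x0 Sx0] S_ge0 [M SM].
have leC (x y : Cplx R) : (x <= y) = (complex.Im x == complex.Im y) && (complex.Re x <= complex.Re y).
  by case: x => a b; case: y => c d; rewrite eq_sym.
pose T : set R := [set complex.Re x | x in S].
have [|||l [lub1 lub2]] := @real_lub R T.
- by exists (complex.Re x0), x0.
- by move=> _ [x Sx <-]; have := S_ge0 _ Sx; rewrite leC => /andP[].
- by exists (complex.Re M) => _ [x Sx <-]; have := SM _ Sx; rewrite leC => /andP[].
have Im0 x : S x -> complex.Im x = 0.
  by move=> /S_ge0; rewrite leC => /andP[/eqP <-].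
exists (l%:C)%C; split=> [x Sx|m Sm].
  by rewrite leC (Im0 _ Sx) eqxx /=; apply: lub1; exists x.
have := Sm _ Sx0; rewrite leC (Im0 _ Sx0) => /andP[/eqP mi _].
rewrite leC /= mi eqxx /=; apply: lub2 => _ [x Sx <-].
by have := Sm _ Sx; rewrite leC => /andP[].
Qed.

Lemma banach_lub (R : realType) (K : numFieldType) :
  banach_scalars R K -> lub_scalars K.
Proof. by case; [exact: real_lub|exact: complex_lub]. Qed.

(** * Families bounded for a collection of seminorms *)

(** The sup norm and the norm of l2 are both suprema of seminorms that involve
    finitely many coordinates each.  The field [sn_fin] makes every seminorm
    continuous for pointwise convergence, whence the completeness of the space
    of families on which the seminorms are bounded; the field [sn_coord] makes
    the supremum a norm that dominates the coordinates. *)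
Record seminorms (K : numFieldType) (I : choiceType) (X : normedModType K) :=
  Seminorms {
  sn_idx : Type;
  sn : sn_idx -> (I -> X) -> K;
  sn_ge0 : forall a f, 0 <= sn a f;
  snD : forall a (f g : I -> X), sn a (f + g) <= sn a f + sn a g;
  snZ : forall a c (f : I -> X), sn a (c *: f) = `|c| * sn a f;
  sn_coord : forall i, exists a, forall f, `|f i| <= sn a f;
  sn_fin : forall a, exists s : seq I, forall f, sn a f <= \sum_(i <- s) `|f i|
}.
Arguments sn {K I X} s a f.
Arguments sn_ge0 {K I X} s a f.
Arguments snD {K I X} s a f g.
Arguments snZ {K I X} s a c f.
Arguments sn_coord {K I X} s i.
Arguments sn_fin {K I X} s a.

Section BoundedFamilies.
Context {K : numFieldType} (HK : lub_scalars K) {I : choiceType}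
  {X : completeNormedModType K} (p : seminorms I X).

Definition bounded_family : {pred I -> X} :=
  fun f => `[< exists M, forall a, sn p a f <= M >].

Lemma bounded_familyP f :
  reflect (exists M, forall a, sn p a f <= M) (f \in bounded_family).
Proof. exact: asboolP. Qed.

Lemma bounded_family_submod : GRing.submod_closed bounded_family.
Proof.
split=> [|c f g /bounded_familyP[M fM] /bounded_familyP[N gN]].
  apply/bounded_familyP; exists 0 => a.
  by have := snZ p a 0 0; rewrite scale0r normr0 mul0r => ->.
apply/bounded_familyP; exists (`|c| * M + N) => a.
by apply: (le_trans (snD _ _ _ _)); rewrite snZ lerD// ler_wpM2l.
Qed.
HB.instance Definition _ :=
  GRing.isSubmodClosed.Build _ _ bounded_family bounded_family_submod.

(** The norm exists only over scalars with suprema: the phantom parameter keeps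
    that hypothesis in the type, where instances can find it. *)
Record bfam (hk : lub_scalars K) :=
  BFam { bfam_val :> I -> X; bfamP : bfam_val \in bounded_family }.
Local Notation B := (bfam HK).
HB.instance Definition _ := [isSub of B for (@bfam_val HK)].
HB.instance Definition _ := [Choice of B by <:].
HB.instance Definition _ := [SubChoice_isSubLmodule of B by <:].

Lemma bfamD (f g : B) i : (f + g) i = f i + g i. Proof. by []. Qed.
Lemma bfamZ c (f : B) i : (c *: f) i = c *: f i. Proof. by []. Qed.
Lemma bfamB (f g : B) i : (f - g) i = f i - g i. Proof. by []. Qed.
Lemma bfam_ext (f g : B) : (forall i, f i = g i) -> f = g.
Proof. by move=> fg; apply/val_inj/funext. Qed.

(** The value 0 is added to the set so that it is not empty when there are no
    seminorms. *)
Definition bfam_norm (f : B) : K :=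
  xget 0 [set l | is_lub [set x | x = 0 \/ exists a, x = sn p a f] l].

Lemma bfam_normP (f : B) : is_lub [set x | x = 0 \/ exists a, x = sn p a f] (bfam_norm f).
Proof.
rewrite /bfam_norm; set S := [set x | _].
have [|||l Sl] := HK (S := S); last by apply: (xgetI 0 Sl).
- by exists 0; left.
- by move=> x [->|[a ->]] //; exact: sn_ge0.
- have /bounded_familyP[M fM] := bfamP f.
  exists (`|M|) => x [->//|[a ->]]; apply: (le_trans (fM a)).
  by rewrite real_ler_norm// ger0_real// (le_trans (sn_ge0 p a f)).
Qed.

Lemma sn_le_norm (f : B) a : sn p a f <= bfam_norm f.
Proof. by apply: (bfam_normP f).1; right; exists a. Qed.

Lemma bfam_norm_ge0 (f : B) : 0 <= bfam_norm f.
Proof. by apply: (bfam_normP f).1; left. Qed.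

Lemma bfam_norm_le (f : B) M : 0 <= M -> (forall a, sn p a f <= M) -> bfam_norm f <= M.
Proof. by move=> M0 fM; apply: (bfam_normP f).2 => x [->//|[a ->]]. Qed.

Lemma coord_le_norm (f : B) i : `|f i| <= bfam_norm f.
Proof. by have [a fa] := sn_coord p i; exact: le_trans (fa f) (sn_le_norm f a). Qed.

Lemma bfam_ler_normD (f g : B) : bfam_norm (f + g) <= bfam_norm f + bfam_norm g.
Proof.
apply: bfam_norm_le => [|a]; first by rewrite addr_ge0// bfam_norm_ge0.
by apply: (le_trans (snD _ _ _ _)); rewrite lerD// sn_le_norm.
Qed.

Lemma bfam_normrZ c (f : B) : bfam_norm (c *: f) = `|c| * bfam_norm f.
Proof.
have le d g : bfam_norm (d *: g) <= `|d| * bfam_norm g.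
  apply: bfam_norm_le => [|a]; first by rewrite mulr_ge0// bfam_norm_ge0.
  by rewrite (snZ p a d g) ler_wpM2l// sn_le_norm.
have [->|c0] := eqVneq c 0.
  apply/eqP; rewrite normr0 mul0r eq_le bfam_norm_ge0 andbT.
  by apply: (le_trans (le _ _)); rewrite normr0 mul0r.
apply/eqP; rewrite eq_le le /=.
have := le c^-1 (c *: f); rewrite scalerA mulVf// scale1r normfV.
by rewrite mulrC ler_pdivlMr ?normr_gt0// mulrC.
Qed.

Lemma bfam_normr0_eq0 (f : B) : bfam_norm f = 0 -> f = 0.
Proof.
move=> f0; apply: bfam_ext => i; apply/normr0_eq0/eqP.
by rewrite eq_le normr_ge0 andbT -f0 coord_le_norm.
Qed.

HB.instance Definition _ :=
  Lmodule_isNormed.Build K B bfam_ler_normD bfam_normrZ bfam_normr0_eq0.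

Lemma bfam_normE (f : B) : `|f| = bfam_norm f. Proof. by []. Qed.

(** A Cauchy filter converges at every coordinate; the bounds of each seminorm
    on differences pass to the pointwise limit, because a seminorm only sees
    finitely many coordinates, and they are uniform over the seminorms. *)
Lemma bfam_complete (F : set_system B) : ProperFilter F -> cauchy F -> cvg F.
Proof.
move=> FF Fc.
have cvi i : cvg ((fun f : B => f i : X) @ F).
  apply: cauchy_cvg; apply: cauchy_exP => e e0.
  have /(cauchyP F) /(_ e e0) [g Fg] := Fc.
  exists (g i); suff: F [set f : B | ball (g i) e (f i)] by [].
  apply: filterS Fg => f /=.
  rewrite -!ball_normE /ball_ /=.
  by apply: le_lt_trans; exact: (coord_le_norm (g - f) i).
pose h i := lim ((fun f : B => f i : X) @ F).
have hlim (g : B) (e : K) : (\forall f \near F, `|f - g| <= e) ->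
    forall a, sn p a (h - g) <= e.
  move=> ge a; have [s sP] := sn_fin p a.
  apply/ler_addgt0Pr => d d0.
  (* The successor keeps the divisor nonzero when s is empty. *)
  have d'0 : 0 < d / (size s).+1%:R by rewrite divr_gt0.
  have near_all (s' : seq I) (c : K) : 0 < c -> \forall f \near F,
      forall i, i \in s' -> `|h i - (f : B) i| <= c.
    move=> c0; elim: s' => [|i s' IH]; first by near=> f => i; rewrite in_nil.
    have hi : \forall f \near F, `|h i - (f : B) i| <= c.
      by have /cvgrPdist_le := cvi i; apply.
    near=> f => j; rewrite in_cons => /orP[/eqP->|]; first by near: f; exact: hi.
    by move: j; near: f; exact: IH.
  near F => f.
  have -> : h - g = (h - f) + ((f - g : B) : I -> X).
    by apply/funext => i; rewrite /= !fctE subrKA.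
  apply: (le_trans (snD _ _ _ _)); rewrite addrC lerD//.
    apply: (le_trans (sn_le_norm _ _)); rewrite -bfam_normE.
    by near: f.
  apply: (le_trans (sP _)).
  have hf : forall i, i \in s -> `|(h - f) i| <= d / (size s).+1%:R.
    by near: f; exact: near_all.
  apply: (@le_trans _ _ (\sum_(i <- s) d / (size s).+1%:R)).
    by rewrite big_seq [leRHS]big_seq; exact: ler_sum.
  rewrite big_const_seq count_predT iter_addr_0.
  by rewrite -[leLHS]mulr_natr -mulrA ler_piMr ?(ltW d0)// ler_pdivrMl// mulr1 ler_nat.
have [g0 [e0 [e0_gt0 g0e0]]] : exists (g0 : B) e, 0 < e /\ \forall f \near F, `|f - g0| <= e.
  have /(cauchyP F) /(_ 1 ltr01) [g Fg] := Fc.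
  exists g, 1; split=> //; near=> f.
  have : ball g 1 f by near: f; exact: Fg.
  by rewrite -ball_normE /= distrC => /ltW.
have hB : h \in bounded_family.
  apply/bounded_familyP; exists (e0 + `|g0|) => a.
  have -> : h = (h - g0) + g0 by apply/funext => i; rewrite !fctE subrK.
  by rewrite (le_trans (snD _ _ _ _))// lerD ?hlim// sn_le_norm.
pose hb : B := BFam HK hB.
suff : F --> hb by move=> Fh; apply/cvg_ex; exists hb.
apply/cvgrPdist_le => e e_gt0.
near=> g.
rewrite bfam_normE; apply: bfam_norm_le => [|a]; first exact: ltW.
apply: hlim; near: g.
have /(cauchyP F) /(_ (e / 2)) [|g1 Fg1] := Fc; first exact: divr_gt0.
suff: F [set g : B | \forall f \near F, `|f - g| <= e] by [].
apply: filterS (Fg1) => g g1g.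
suff: F [set f : B | `|f - g| <= e] by [].
apply: filterS (Fg1) => f g1f /=.
by have := ball_splitr g1f g1g; rewrite -ball_normE /= => /ltW.
Unshelve. all: by end_near. Qed.
HB.instance Definition _ := Uniform_isComplete.Build B bfam_complete.
End BoundedFamilies.

(** * The abelian group of the edges of a graph *)

Section EdgeGroup.
Context {Om : Type} (E : set (Om * Om)).

Definition vertex_delta (u : Om) : Om -> int := fun x => Posz `[< x = u >].

(** Coefficients in the integers, and not modulo 2, so that an edge and the
    reverse edge have different images. *)
Definition edge_elt (u v : Om) : Om -> int := vertex_delta u - vertex_delta v.

Lemma edge_eltxx u : edge_elt u u = 0. Proof. exact: subrr. Qed.

Lemma edge_eltD u v w : edge_elt u v + edge_elt v w = edge_elt u w.
Proof. by rewrite /edge_elt addrA subrK. Qed.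

(** Only u has coefficient 1 in d_u - d_v, and only v has coefficient -1. *)
Lemma edge_elt_inj u v u' v' :
  u <> v -> edge_elt u v = edge_elt u' v' -> u = u' /\ v = v'.
Proof.
move=> uv e.
have := congr1 (fun f => f u) e; have := congr1 (fun f => f v) e.
rewrite /edge_elt !fctE /vertex_delta.
have -> : `[< u = u >] by apply/asboolP.
have -> : `[< v = v >] by apply/asboolP.
have -> : `[< u = v >] = false by apply/asboolP.
have -> : `[< v = u >] = false by apply/asboolP => /esym.
by do 4!case: asboolP => //.
Qed.

Lemma edge_elt_neq0 u v : u <> v -> edge_elt u v <> 0.
Proof. by move=> uv; rewrite -(edge_eltxx u) => /(edge_elt_inj uv)[_ /esym]. Qed.

(** By injectivity at most one edge that is not a loop lies above each element
    of the group, and loops lie above 0: prescribe the value there, and take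
    the trivial value [z0] at all other elements.  The predicate [P] transports
    what holds of every member of the family, such as being a contraction. *)
Lemma edge_extension (Z : Type) (P : Z -> Prop) (phi : Om -> Om -> Z) (z0 : Z) :
  P z0 -> (forall u v, E (u, v) -> P (phi u v)) ->
  (forall u, E (u, u) -> phi u u = z0) ->
  exists psi : (Om -> int) -> Z, [/\ forall g, P (psi g), psi 0 = z0 &
    forall u v, E (u, v) -> psi (edge_elt u v) = phi u v].
Proof.
move=> Pz0 Pphi phi_id.
pose Q g (uv : Om * Om) := [/\ E uv, uv.1 <> uv.2 & g = edge_elt uv.1 uv.2].
have ext g : exists z, P z /\ ((forall uv, ~ Q g uv) -> z = z0) /\
    forall uv, Q g uv -> z = phi uv.1 uv.2.
  have [[[u v] [/= Euv uv ->]]|nQ] := pselect (exists uv, Q g uv).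
    exists (phi u v); split; first exact: Pphi.
    split=> [/(_ (u, v)) []//|[u' v'] [/= _ _]].
    by move=> /(edge_elt_inj uv)[-> ->].
  by exists z0; split=> //; split=> // uv Quv; case: nQ; exists uv.
have [psi psiP] := choice ext.
exists psi; split=> [g||u v Euv]; first by have [] := psiP g.
- have [_ [-> // uv]] := psiP 0.
  by case=> _ uv0 /esym; exact: edge_elt_neq0.
- have [_ [psi0 psiE]] := psiP (edge_elt u v).
  have [uv|uv] := pselect (u = v); last by rewrite (psiE (u, v)).
  subst v; rewrite psi0 ?phi_id// => uv [_ uv0].
  by rewrite edge_eltxx => /esym; exact: edge_elt_neq0.
Qed.
End EdgeGroup.

(** * Bounded functions and their translations *)

Section SupNorm.
Context {K : numFieldType} (HK : lub_scalars K) {I : choiceType}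
  {X : completeNormedModType K}.

Definition coord_norm (i : I) (f : I -> X) : K := `|f i|.

Lemma coord_norm_ge0 i f : 0 <= coord_norm i f. Proof. exact: normr_ge0. Qed.

Lemma coord_normD i (f g : I -> X) :
  coord_norm i (f + g) <= coord_norm i f + coord_norm i g.
Proof. exact: ler_normD. Qed.

Lemma coord_normZ i c (f : I -> X) : coord_norm i (c *: f) = `|c| * coord_norm i f.
Proof. exact: normrZ. Qed.

Lemma coord_norm_coord i : exists a, forall f : I -> X, `|f i| <= coord_norm a f.
Proof. by exists i => f. Qed.

Lemma coord_norm_fin i :
  exists s : seq I, forall f : I -> X, coord_norm i f <= \sum_(i <- s) `|f i|.
Proof. by exists [:: i] => f; rewrite big_seq1. Qed.

Definition sup_seminorms : seminorms I X := Seminorms coord_norm_ge0 coord_normD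
  coord_normZ coord_norm_coord coord_norm_fin.

Definition linf := bfam sup_seminorms HK.

HB.instance Definition _ := CompleteNormedModule.on linf.

Lemma linf_le (f : linf) M : 0 <= M -> (forall i, `|f i| <= M) -> `|f| <= M.
Proof. exact: (@bfam_norm_le _ HK _ _ sup_seminorms f M). Qed.

Lemma linf_coord (f : linf) i : `|f i| <= `|f|.
Proof. exact: (sn_le_norm (p := sup_seminorms) f i). Qed.

Lemma linf_bounded (f : I -> X) M :
  (forall i, `|f i| <= M) -> f \in bounded_family sup_seminorms.
Proof. by move=> fM; apply/bounded_familyP; exists M. Qed.

Definition mk_linf (f : I -> X) M (fM : forall i, `|f i| <= M) : linf :=
  BFam HK (linf_bounded fM).
End SupNorm.
Arguments linf {K} HK I X.

Section Translation.
Context {K : numFieldType} (HK : lub_scalars K) {G : zmodType}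
  {X : completeNormedModType K}.
Notation L := (linf HK G X).

Definition translate (g : G) (f : L) : L :=
  mk_linf HK (fun h => linf_coord f (h + g)).

Lemma translateE g f h : translate g f h = f (h + g). Proof. by []. Qed.

Lemma translate0 f : translate 0 f = f.
Proof. by apply: bfam_ext => h; rewrite translateE addr0. Qed.

Lemma translateD g g' f : translate (g + g') f = translate g (translate g' f).
Proof. by apply: bfam_ext => h; rewrite !translateE addrA. Qed.

Lemma translateK g : cancel (translate g) (translate (- g)).
Proof. by move=> f; rewrite -translateD addNr translate0. Qed.

Lemma translate_linear g : linear (translate g).
Proof. by move=> c f f'; apply: bfam_ext. Qed.

Lemma translate_isometry g : linear_isometry (translate g).
Proof.
have le g' f : `|translate g' f| <= `|f|.
  by apply: linf_le => [|h]; [exact: normr_ge0|exact: (linf_coord f (h + g'))].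
split=> [|f]; first exact: translate_linear.
by apply/eqP; rewrite eq_le le -{1}(translateK g f) le.
Qed.

Lemma translate_surj g : surjective (translate g).
Proof.
by move=> f; exists (translate (- g) f); rewrite -translateD subrr translate0.
Qed.

(** A representation of a group composed with a map that is additive along
    composable edges is a divisible system. *)
Lemma translate_divisible (Om : Type) (E : set (Om * Om)) (d : Om -> Om -> G) :
  (forall u, d u u = 0) -> (forall u v w, d u v + d v w = d u w) ->
  divisible_system E (fun u v => translate (d u v)).
Proof.
move=> d0 dD; split=> [u v Euv|u Eu|u v w Euv Evw Euw].
- have [? iso] := translate_isometry (d u v).
  by split=> //; exists 1 => f; rewrite iso mul1r.
- by apply/funext => f; rewrite d0 translate0.
- by apply/funext => f; rewrite /= -translateD dD.
Qed.

Definition eval0 (f : L) : X := f 0.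

Lemma eval0_contraction : linear_contraction eval0.
Proof. by split=> // f; exact: (linf_coord f 0). Qed.

Section Orbit.
Variables (psi : G -> X -> X) (psi_contr : forall g, linear_contraction (psi g)).

(** The embedding r of the dilation: x goes to the function g |-> psi g x. *)
Definition orbit_fun (x : X) : L := mk_linf HK (fun g => (psi_contr g).2 x).

Lemma orbit_fun_isometry : psi 0 = id -> linear_isometry orbit_fun.
Proof.
move=> psi0; split=> [c x y|x].
  by apply: bfam_ext => g; rewrite /= (psi_contr g).1.
apply/eqP; rewrite eq_le linf_le//; last by move=> g; exact: (psi_contr g).2.
by rewrite -{1}[x]/(id x) -psi0; exact: (linf_coord (orbit_fun x) 0).
Qed.

Lemma eval0_orbit : psi 0 = id -> eval0 \o orbit_fun = id.
Proof. by move=> psi0; apply/funext => x; rewrite /= -[RHS]/(id x) -psi0. Qed.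

Lemma eval0_translate_orbit g : eval0 \o translate g \o orbit_fun = psi g.
Proof. by apply/funext => x; rewrite -[in RHS](add0r g). Qed.
End Orbit.

Lemma eval0_surj : surjective eval0.
Proof.
have idC (g : G) : linear_contraction (@id X) by [].
by move=> x; exists (orbit_fun idC x).
Qed.
End Translation.

(** * Dilation of contractions *)

Lemma banach_dilation (R : realType) (Om : Type) (E : set (Om * Om))
    (K : numFieldType) (HK : banach_scalars R K) (X : completeNormedModType K)
    (phi : Om -> Om -> X -> X) :
  (forall u v, E (u, v) -> linear_contraction (phi u v)) ->
  identity_axiom E phi ->
  exists (Xt : completeNormedModType K) (U : Om -> Om -> Xt -> Xt)
         (j : Xt -> X) (r : X -> Xt),
    [/\ divisible_system E U,
        forall u v, E (u, v) -> linear_isometry (U u v) /\ surjective (U u v),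
        linear_contraction j /\ surjective j,
        linear_isometry r /\ j \o r = id &
        forall u v, E (u, v) -> j \o U u v \o r = phi u v].
Proof.
move=> phi_contr phi_id.
have [|psi [psi_contr psi0 psiE]] := edge_extension _ phi_contr phi_id; first by [].
exists (linf (banach_lub HK) (Om -> int) X), (fun u v => translate (edge_elt u v)),
  (@eval0 _ _ _ _), (orbit_fun (banach_lub HK) psi_contr).
split.
- by apply: translate_divisible => *; rewrite ?edge_eltxx ?edge_eltD.
- by split; [exact: translate_isometry|exact: translate_surj].
- by split; [exact: eval0_contraction|exact: eval0_surj].
- by split; [exact: orbit_fun_isometry|exact: eval0_orbit].
- by move=> u v Euv; rewrite eval0_translate_orbit psiE.
Qed.

(** * Bounded functions with values in a C*-algebra *)

Section CStarSup.
Context {R : realType} {I : choiceType} {A : cstarAlgType R}.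

Definition cstar_linf := linf (@complex_lub R) I A.
HB.instance Definition _ := CompleteNormedModule.on cstar_linf.
Implicit Types f g h : cstar_linf.

Lemma cstar_linf_ext f g : (forall i, f i = g i) -> f = g.
Proof. exact: bfam_ext. Qed.

(** From |y|^2 = |y^* y| <= |y^*| |y|, applied to y and to its adjoint. *)
Lemma norm_star (x : A) : `|star x| = `|x|.
Proof.
have le (y : A) : `|y| <= `|star y|.
  have [->|y0] := eqVneq y 0; first by rewrite normr0.
  have n0 : 0 < `|y| by rewrite normr_gt0.
  rewrite -(ler_pM2r n0) -expr2 -norm_star_cmul.
  exact: norm_cmul.
by apply/eqP; rewrite eq_le le -{2}(starK x) le.
Qed.

Lemma linf_mul_bounded f g i : `|cmul (f i) (g i)| <= `|f| * `|g|.
Proof.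
by apply: (le_trans (norm_cmul _ _)); rewrite ler_pM// linf_coord.
Qed.

Lemma linf_star_bounded f i : `|star (f i)| <= `|f|.
Proof. by rewrite norm_star linf_coord. Qed.

Lemma linf_one_bounded (i : I) : `|cone : A| <= `|cone : A|. Proof. by []. Qed.

Definition linf_mul f g : cstar_linf := mk_linf _ (linf_mul_bounded f g).
Definition linf_star f : cstar_linf := mk_linf _ (linf_star_bounded f).
Definition linf_one : cstar_linf := mk_linf _ linf_one_bounded.

Lemma linf_mulA : associative linf_mul.
Proof. by move=> f g h; apply: cstar_linf_ext => i; exact: cmulA. Qed.
Lemma linf_mul1 : left_id linf_one linf_mul.
Proof. by move=> f; apply: cstar_linf_ext => i; exact: cmul1x. Qed.
Lemma linf_mulr1 : right_id linf_one linf_mul.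
Proof. by move=> f; apply: cstar_linf_ext => i; exact: cmulx1. Qed.
Lemma linf_mulDl : left_distributive linf_mul +%R.
Proof. by move=> f g h; apply: cstar_linf_ext => i; exact: cmulDl. Qed.
Lemma linf_mulDr : right_distributive linf_mul +%R.
Proof. by move=> f g h; apply: cstar_linf_ext => i; exact: cmulDr. Qed.
Lemma linf_scaleAl (a : Cplx R) f g : a *: linf_mul f g = linf_mul (a *: f) g.
Proof. by apply: cstar_linf_ext => i; exact: cscaleAl. Qed.
Lemma linf_scaleAr (a : Cplx R) f g : a *: linf_mul f g = linf_mul f (a *: g).
Proof. by apply: cstar_linf_ext => i; exact: cscaleAr. Qed.
Lemma linf_starK : involutive linf_star.
Proof. by move=> f; apply: cstar_linf_ext => i; exact: starK. Qed.
Lemma linf_starD : {morph linf_star : f g / f + g}.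
Proof. by move=> f g; apply: cstar_linf_ext => i; exact: starD. Qed.
Lemma linf_starZ (a : Cplx R) f : linf_star (a *: f) = Num.conj a *: linf_star f.
Proof. by apply: cstar_linf_ext => i; exact: starZ. Qed.
Lemma linf_starM f g : linf_star (linf_mul f g) = linf_mul (linf_star g) (linf_star f).
Proof. by apply: cstar_linf_ext => i; exact: starM. Qed.

Lemma linf_norm_mul f g : `|linf_mul f g| <= `|f| * `|g|.
Proof. by apply: linf_le => [|i]; [rewrite mulr_ge0|exact: linf_mul_bounded]. Qed.

(** The upper bound holds at every point.  Conversely |f i|^2 is the norm of a
    value of the product, so that |f i| is at most the square root of the norm
    of the product. *)
Lemma linf_norm_star_mul f : `|linf_mul (linf_star f) f| = `|f| ^+ 2.
Proof.
apply/eqP; rewrite eq_le; apply/andP; split.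
  apply: linf_le => [|i]; first by rewrite exprn_ge0.
  by rewrite norm_star_cmul lerXn2r ?nnegrE// linf_coord.
set q := `|linf_mul _ _|; have q0 : 0 <= q by exact: normr_ge0.
rewrite -[q]sqrtCK lerXn2r ?nnegrE ?sqrtC_ge0//.
apply: linf_le => [|i]; first by rewrite sqrtC_ge0.
rewrite -(@ler_pXn2r _ 2) ?nnegrE ?sqrtC_ge0// sqrtCK -norm_star_cmul.
exact: (linf_coord (linf_mul (linf_star f) f) i).
Qed.

HB.instance Definition _ := isCStarAlgebra.Build R cstar_linf
  linf_mulA linf_mul1 linf_mulr1 linf_mulDl linf_mulDr linf_scaleAl linf_scaleAr
  linf_starK linf_starD linf_starZ linf_starM linf_norm_mul linf_norm_star_mul.

(** Choose a root b i with f i = (b i)^* (b i) at every point; the C*-identity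
    gives |b i|^2 = |f i|, so these roots form a bounded function. *)
Lemma cstar_linf_pos (f : cstar_linf) : (forall i, cstar_pos (f i)) -> cstar_pos f.
Proof.
move=> /choice[b fb].
have bE i : `|b i| <= sqrtC `|f|.
  rewrite -(@ler_pXn2r _ 2) ?nnegrE ?sqrtC_ge0// sqrtCK -norm_star_cmul -fb.
  exact: linf_coord.
by exists (mk_linf _ bE : cstar_linf); apply: cstar_linf_ext => i; exact: fb.
Qed.
End CStarSup.
Arguments cstar_linf {R} I A.

(** * Dilation of positive unital maps *)

(** The dilation space and maps are those of [banach_dilation]; translations
    and evaluation respect pointwise operations. *)
Lemma cstar_dilation (R : realType) (Om : Type) (E : set (Om * Om))
    (A : cstarAlgType R) (Phi : Om -> Om -> A -> A) :
  (forall u v, E (u, v) -> linear_contraction (Phi u v)) ->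
  identity_axiom E Phi ->
  (forall u v, E (u, v) -> positive_map (Phi u v) /\ unital_map (Phi u v)) ->
  exists (At : cstarAlgType R) (U : Om -> Om -> At -> At)
         (j : At -> A) (r : A -> At),
    (cstar_commutative A -> cstar_commutative At) /\
    [/\ divisible_system E U,
        forall u v, E (u, v) -> star_automorphism (U u v),
        unital_star_hom j /\ surjective j,
        [/\ linear_isometry r, positive_map r, unital_map r & j \o r = id] &
        forall u v, E (u, v) -> j \o U u v \o r = Phi u v].
Proof.
move=> contr Phi_id pu.
have [|||psi [psiP psi0 psiE]] := @edge_extension _ E _
    (fun f : A -> A => [/\ linear_contraction f, positive_map f & unital_map f]) Phi id.
- by [].
- by move=> u v Euv; have [] := pu _ _ Euv; split=> //; exact: contr.
- exact: Phi_id.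
have psi_contr g : linear_contraction (psi g) by have [] := psiP g.
pose r : A -> cstar_linf (Om -> int) A := orbit_fun (@complex_lub R) psi_contr.
have r_iso : linear_isometry r := orbit_fun_isometry _ psi_contr psi0.
exists (cstar_linf (Om -> int) A), (fun u v => translate (edge_elt u v)),
  (@eval0 _ _ _ _), r.
split.
  by move=> comm f g; apply: cstar_linf_ext => i; exact: comm.
split.
- by apply: translate_divisible => *; rewrite ?edge_eltxx ?edge_eltD.
- move=> u v _; split; last first.
    exists (translate (- edge_elt u v)); first exact: translateK.
    by move=> f; have := translateK (- edge_elt u v) f; rewrite opprK.
  by split=> [a f g||f g|f]; exact: cstar_linf_ext.
- by split; [split|exact: eval0_surj].
- split=> [//|||]; last exact: (eval0_orbit _ psi_contr psi0).
  + split=> [|a a_pos]; first exact: r_iso.1.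
    by apply: cstar_linf_pos => g; have [_ [_ pos] _] := psiP g; exact: pos.
  + by apply: cstar_linf_ext => g; have [_ _] := psiP g.
- by move=> u v Euv; rewrite eval0_translate_orbit psiE.
Qed.

(** * The complex line as a Hilbert space *)

Section ComplexLine.
Context {R : realType}.
Local Notation C := (Cplx R).

(** Real and imaginary parts are 1-Lipschitz, so completeness is inherited from
    the real line. *)
Lemma complex_cauchy_cvg (F : set_system C) : ProperFilter F -> cauchy F -> cvg F.
Proof.
move=> FF /(cauchyP F) Fc.
have RFc (f : C -> R) : (forall x y : C, (`|f x - f y|%:C)%C <= `|x - y| :> C) ->
    cvg (f @ F).
  move=> lip; apply: cauchy_cvg; apply: cauchy_exP => e e0.
  have [|z Fz] := Fc (e%:C)%C; first by rewrite ltcR.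
  exists (f z); suff: F [set w | ball (f z) e (f w)] by [].
  apply: filterS Fz => w; rewrite -!ball_normE /ball_ /= => zw.
  by rewrite -ltcR; exact: le_lt_trans zw.
have cRe : cvg (@complex.Re R @ F).
  by apply: RFc => x y; have := @normc_ge_Re R (x - y); rewrite raddfB.
have cIm : cvg (@complex.Im R @ F).
  apply: RFc => x y; have := @normc_ge_Re R ((x - y) * 'i%C).
  rewrite ReiNIm normrN raddfB normrM.
  have -> : `|('i%C : R[i])| = 1 :> R[i].
    by rewrite normc_def /= expr0n expr1n add0r sqrtr1.
  by rewrite mulr1.
pose l : C := Complex (lim (@complex.Re R @ F)) (lim (@complex.Im R @ F)).
apply/cvg_ex; exists l; apply/cvgrPdist_le => e e0.
have eE : e = (complex.Re e)%:C%C.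
  by rewrite RRe_real// realE (ltW e0).
have e'0 : 0 < complex.Re e / 2.
  by apply: divr_gt0 => //; rewrite -ltcR -eE.
have /cvgrPdist_le /(_ _ e'0) nRe := cRe.
have /cvgrPdist_le /(_ _ e'0) nIm := cIm.
near=> z.
have -> : l - z = (complex.Re (l - z))%:C%C + 'i%C * (complex.Im (l - z))%:C%C :> C.
  exact: complexE.
apply: (le_trans (ler_normD _ _)).
have -> : e = (complex.Re e / 2)%:C%C + (complex.Re e / 2)%:C%C :> C.
  by rewrite -rmorphD -splitr.
rewrite normrM.
have -> : `|('i%C : R[i])| = 1 :> C.
  by rewrite normc_def /= expr0n expr1n add0r sqrtr1.
rewrite mul1r; apply: lerD; rewrite normc_def /= expr0n /= addr0 sqrtr_sqr lecR.
  rewrite raddfB /=; near: z; exact: nRe.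
rewrite raddfB /=; near: z; exact: nIm.
Unshelve. all: by end_near. Qed.

(** An alias, so that the complete and Hilbert structures do not interfere with
    the number field structure of the scalars. *)
Definition cline : Type := C.
HB.instance Definition _ := NormedModule.copy cline C.
HB.instance Definition _ := Uniform_isComplete.Build cline complex_cauchy_cvg.

Definition cline_inner (x y : cline) : C := (x : C) * Num.conj (y : C).

Lemma cline_inner_linl : forall u', GRing.linear_for *%R (cline_inner ^~ u').
Proof. by move=> z a x y; rewrite /cline_inner mulrDl mulrA. Qed.
Lemma cline_inner_linr : forall u, GRing.linear_for (Num.conj \; *%R) (cline_inner u).
Proof.
move=> z a x y; rewrite /cline_inner rmorphD rmorphM mulrDr /=.
by rewrite mulrCA.
Qed.
HB.instance Definition _ := bilinear_isBilinear.Build C cline cline C *%R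
  (Num.conj \; *%R) cline_inner (conj cline_inner_linl cline_inner_linr).
Lemma cline_innerC x y : cline_inner x y = (-1) ^+ false * Num.conj (cline_inner y x).
Proof.
rewrite expr0 mul1r /cline_inner rmorphM /=.
by rewrite mulrC conjCK. Qed.
HB.instance Definition _ := isHermitianSesquilinear.Build C cline false Num.conj
  cline_inner cline_innerC.
Lemma cline_inner_gt0 u : u != 0 -> 0 < cline_inner u u.
Proof. by move=> u0; rewrite mul_conjC_gt0. Qed.
HB.instance Definition _ := isDotProduct.Build C cline cline_inner cline_inner_gt0.
Lemma cline_norm (x : cline) : `|x| ^+ 2 = cline_inner x x.
Proof. exact: normCK. Qed.
HB.instance Definition _ := isHilbert.Build R cline cline_norm.
End ComplexLine.
Arguments cline R : clear implicits.

(** * Unordered sums *)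

#[local] Existing Instance totally_filter.

Lemma fsum_split (V : zmodType) (I : choiceType) (x : I -> V) (A B : {fset I}) :
  (A `<=` B)%fset ->
  \sum_(i <- B) x i = \sum_(i <- A) x i + \sum_(i <- (B `\` A)%fset) x i.
Proof.
move=> AB; rewrite (big_fsetID _ (mem A)) /=; congr (_ + _).
  rewrite (_ : [fset i in B | i \in A]%fset = A)//.
  apply/fsetP => i; rewrite !inE /= andbC.
  by case: (boolP (i \in A)) => // /(fsubsetP AB) ->.
rewrite (_ : [fset i in B | i \notin A]%fset = (B `\` A)%fset)//.
by apply/fsetP => i; rewrite !inE /= andbC.
Qed.

Lemma fsumU (V : zmodType) (I : choiceType) (x : I -> V) (A B : {fset I}) :
  [disjoint A & B]%fset ->
  \sum_(i <- (A `|` B)%fset) x i = \sum_(i <- A) x i + \sum_(i <- B) x i.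
Proof.
move=> AB; rewrite (@fsum_split _ _ x A); last exact: fsubsetUl.
by rewrite fsetDUl fsetDv fset0U (fsetDidPl _ _ _)// fdisjoint_sym.
Qed.

Section Sums.
Context {R : realType}.
Local Notation C := (Cplx R).
Context {I : choiceType}.

(** Convergence of the net of finite partial sums, written with explicit
    bounds; [is_sumP] relates it to the filter of finite sets. *)
Definition is_sum {V : normedModType C} (x : I -> V) (l : V) :=
  forall e : C, 0 < e -> exists A : {fset I}, forall B, (A `<=` B)%fset ->
    `|l - \sum_(i <- B) x i| <= e.

Lemma partial_sumE (V : zmodType) (x : I -> V) A :
  partial_sum x A = \sum_(i <- A) x i.
Proof. by rewrite big_seq_fsetE. Qed.

Lemma eq_is_sum (V : normedModType C) (x y : I -> V) l :
  x =1 y -> is_sum x l -> is_sum y l.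
Proof. by move=> /funext ->. Qed.

Lemma is_sum_0 (V : normedModType C) : is_sum (fun=> 0 : V) 0.
Proof.
by move=> e e0; exists fset0 => B _; rewrite big1// subrr normr0 ltW.
Qed.

Lemma is_sumP (V : normedModType C) (x : I -> V) l :
  is_sum x l <-> partial_sum x @ totally --> l.
Proof.
split=> [xl|/cvgrPdist_le xl e e0].
  apply/cvgrPdist_le => e e0; have [A AP] := xl e e0.
  by exists A => // B /= AB; rewrite partial_sumE; exact: AP.
have [A _ AP] := xl e e0; exists A => B AB.
by have := AP B AB; rewrite /= partial_sumE.
Qed.

Lemma sum_is_sum (V : normedModType C) (x : I -> V) l :
  is_sum x l -> summability.sum x = l.
Proof.
move=> /is_sumP xl; apply: cvg_lim => //; exact: norm_hausdorff.
Qed.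

Lemma is_sum_unique (V : normedModType C) (x : I -> V) l l' :
  is_sum x l -> is_sum x l' -> l = l'.
Proof. by move=> /sum_is_sum <- /sum_is_sum. Qed.

Lemma is_sumD (V : normedModType C) (x y : I -> V) l m :
  is_sum x l -> is_sum y m -> is_sum (fun i => x i + y i) (l + m).
Proof.
move=> xl ym e e0; have e20 : 0 < e / 2 by rewrite divr_gt0.
have [A AP] := xl _ e20; have [B BP] := ym _ e20.
exists (A `|` B)%fset => D; rewrite fsubUset => /andP[AD BD].
rewrite big_split /= opprD addrACA [leRHS]splitr.
by apply: (le_trans (ler_normD _ _)); rewrite lerD ?AP ?BP.
Qed.

(** Bounded operators commute with sums. *)
Lemma is_sum_map (V W : normedModType C) (f : V -> W) (x : I -> V) l :
  bounded_operator f -> is_sum x l -> is_sum (fun i => f (x i)) (f l).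
Proof.
move=> [flin [M fM]] xl e e0.
have N0 : 0 < `|M| + 1 by rewrite ltr_wpDl.
have [A AP] := xl (e / (`|M| + 1)) (divr_gt0 e0 N0).
pose fl := GRing.isLinear.Build C V W *:%R f flin.
pose F : {linear V -> W} := HB.pack f fl.
exists A => B AB; rewrite -[f]/(F : V -> W) -raddf_sum -raddfB /=.
apply: (le_trans (fM _)).
have M1 : M * `|l - \sum_(i <- B) x i| <= (`|M| + 1) * `|l - \sum_(i <- B) x i|.
  have [->|n0] := eqVneq (`|l - \sum_(i <- B) x i|) 0; first by rewrite !mulr0.
  have p0 : 0 < `|l - \sum_(i <- B) x i| by rewrite lt_def n0 normr_ge0.
  have MR : 0 <= M.
    have := fM (l - \sum_(i <- B) x i).
    move=> /(le_trans (normr_ge0 _)); rewrite pmulr_lge0//.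
  by rewrite ler_wpM2r// ger0_norm// lerDl.
apply: (le_trans M1); rewrite mulrC -ler_pdivlMr//; exact: AP.
Qed.

Lemma is_sum_norm_le (V : normedModType C) (x : I -> V) l (M : C) :
  is_sum x l -> (forall A : {fset I}, `|\sum_(i <- A) x i| <= M) -> `|l| <= M.
Proof.
move=> xl xM; apply/ler_addgt0Pr => e e0; have [A AP] := xl e e0.
rewrite -(subrK (\sum_(i <- A) x i) l) addrC.
rewrite (le_trans (ler_normD _ _))// addrC addrC lerD//; exact: AP.
Qed.

Section Nonneg.
Variables (y : I -> C) (y0 : forall i, 0 <= y i).

Lemma fsum_ge0 (A : {fset I}) : 0 <= \sum_(i <- A) y i.
Proof. exact: sumr_ge0. Qed.

Lemma fsum_mono (A B : {fset I}) : (A `<=` B)%fset ->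
  \sum_(i <- A) y i <= \sum_(i <- B) y i.
Proof. by move=> AB; rewrite (fsum_split y AB) lerDl fsum_ge0. Qed.

(** The partial sums increase with the finite set, so their supremum is their
    limit. *)
Lemma nonneg_is_sum M : (forall A : {fset I}, \sum_(i <- A) y i <= M) ->
  exists2 l, is_sum y l & is_lub [set s | exists A : {fset I}, s = \sum_(i <- A) y i] l.
Proof.
move=> yM.
have [|||l llub] := @complex_lub R [set s | exists A : {fset I}, s = \sum_(i <- A) y i].
- by exists (\sum_(i <- fset0) y i), fset0.
- by move=> _ [A ->]; exact: fsum_ge0.
- by exists M => _ [A ->].
have yl (A : {fset I}) : \sum_(i <- A) y i <= l by apply: llub.1; exists A.
have l0 : 0 <= l by apply: le_trans (yl fset0); exact: fsum_ge0.
exists l => // e e0.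
have [A Ae] : exists A : {fset I}, l - e <= \sum_(i <- A) y i.
  apply: contrapT => nA; have : l <= l - e.
    apply: llub.2 => _ [A ->]; apply: ltW; rewrite real_ltNge.
    - by apply/negP => le; apply: nA; exists A.
    - exact/ger0_real/fsum_ge0.
    - by rewrite rpredB// ger0_real// ltW.
  by rewrite lerDl oppr_ge0 => /(lt_le_trans e0); rewrite ltxx.
exists A => B AB; rewrite ger0_norm ?subr_ge0//.
by rewrite lerBlDr -lerBlDl (le_trans Ae)// fsum_mono.
Qed.

Lemma is_sum_lub l :
  is_sum y l -> is_lub [set s | exists A : {fset I}, s = \sum_(i <- A) y i] l.
Proof.
move=> yl; have [A AP] := yl 1 ltr01.
have [B|l' yl' l'lub] := @nonneg_is_sum (`|l| + 1); last first.
  by rewrite (is_sum_unique yl yl').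
apply: (le_trans (fsum_mono (fsubsetUr A B))).
rewrite -[leLHS]ger0_norm ?fsum_ge0// -lerBlDl.
apply: (le_trans (lerB_dist _ _)); rewrite distrC; apply: AP; exact: fsubsetUl.
Qed.

Lemma fsum_le_is_sum l (A : {fset I}) : is_sum y l -> \sum_(i <- A) y i <= l.
Proof. by move=> /is_sum_lub[+ _]; apply; exists A. Qed.

Lemma is_sum_le l M :
  is_sum y l -> (forall A : {fset I}, \sum_(i <- A) y i <= M) -> l <= M.
Proof. by move=> /is_sum_lub[_ lM] yM; apply: lM => _ [A ->]. Qed.

Lemma is_sum_ge0 l : is_sum y l -> 0 <= l.
Proof. by move=> /(fsum_le_is_sum fset0); apply: le_trans; exact: fsum_ge0. Qed.

(** A finite set whose partial sum is within e of the total leaves at most e to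
    any set disjoint from it. *)
Lemma nonneg_tail M : (forall A : {fset I}, \sum_(i <- A) y i <= M) ->
  forall e : C, 0 < e -> exists A : {fset I}, forall B, [disjoint A & B]%fset ->
    \sum_(i <- B) y i <= e.
Proof.
move=> /nonneg_is_sum[l yl _] e e0; have [A AP] := yl e e0; exists A => B AB.
have := fsum_le_is_sum (A `|` B)%fset yl.
rewrite fsumU// -lerBrDl => /le_trans; apply.
have := AP A (fsubset_refl _); rewrite ger0_norm// subr_ge0.
exact: fsum_le_is_sum.
Qed.
End Nonneg.

Lemma cauchy_is_sum (V : completeNormedModType C) (x : I -> V) :
  (forall e : C, 0 < e -> exists A : {fset I}, forall B, [disjoint A & B]%fset ->
    `|\sum_(i <- B) x i| <= e) -> exists l, is_sum x l.
Proof.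
move=> xc; suff /cvg_ex[l xl] : cvg (partial_sum x @ totally).
  by exists l; apply/is_sumP.
apply: cauchy_cvg; apply: cauchy_exP => e e0.
have [A AP] := xc (e / 2) (divr_gt0 e0 (ltr0Sn _ _)).
exists (\sum_(i <- A) x i); exists A => // B /= AB.
rewrite partial_sumE -ball_normE /ball_ /= (fsum_split x AB) opprD addNKr normrN.
apply: (le_lt_trans (AP _ _)); last by rewrite ltr_pdivrMr// ltr_pMr// ltr1n.
by apply/fdisjointP => i iA; rewrite inE iA.
Qed.

Lemma abs_is_sum (V : completeNormedModType C) (x : I -> V) (M : C) :
  (forall A : {fset I}, \sum_(i <- A) `|x i| <= M) ->
  exists2 l, is_sum x l & `|l| <= M.
Proof.
move=> xM; have [|l xl] := @cauchy_is_sum V x.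
  move=> e e0; have [A AP] := nonneg_tail (fun i => normr_ge0 (x i)) xM e0.
  by exists A => B AB; apply: (le_trans (ler_norm_sum _ _ _)); exact: AP.
exists l => //; apply: (is_sum_norm_le xl) => A.
exact: (le_trans (ler_norm_sum _ _ _)).
Qed.
End Sums.

(** * Inner products, orthonormal bases and adjoints *)

(** A bound of an operator can only be negative if the domain is trivial. *)
Lemma bounded_cst_ge0 (K : numFieldType) (V W : normedModType K) (T : V -> W) :
  bounded_operator T -> exists2 M, 0 <= M & forall v, `|T v| <= M * `|v|.
Proof.
move=> [_ [M TM]]; have [->|nT] := pselect (T = fun=> 0).
  by exists 0 => // x; rewrite normr0 mul0r.
exists M => //; have [x Tx0] : exists x, T x != 0.
  apply: contrapT => nx; apply: nT; apply/funext => x; apply/eqP.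
  by apply: contrapT => /negP Tx0; apply: nx; exists x.
have Tx : 0 < `|T x| by rewrite normr_gt0.
have := TM x => /(lt_le_trans Tx) h.
have x0 : 0 < `|x|.
  rewrite normr_gt0; apply/eqP => x0; move: h.
  by rewrite x0 normr0 mulr0 ltxx.
by move: h; rewrite pmulr_lgt0// => /ltW.
Qed.
Section Inner.
Context {R : realType}.
Local Notation C := (Cplx R).
Context {H : hilbertType R}.
Implicit Types x y z : H.

Lemma innerDl x y z : <|x + y, z|> = <|x, z|> + <|y, z|>.
Proof. exact: linearDl. Qed.
Lemma innerDr x y z : <|z, x + y|> = <|z, x|> + <|z, y|>.
Proof. exact: linearDr. Qed.
Lemma innerZl (a : C) x y : <|a *: x, y|> = a * <|x, y|>.
Proof. exact: linearZl_LR. Qed.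
Lemma innerZr (a : C) x y : <|x, a *: y|> = Num.conj a * <|x, y|>.
Proof. exact: linearZr_LR. Qed.
Lemma inner0l x : <|0, x|> = 0 :> C.
Proof. exact: linear0l. Qed.
Lemma inner0r x : <|x, 0|> = 0 :> C.
Proof. exact: linear0r. Qed.
Lemma innerNl x y : <|- x, y|> = - <|x, y|>.
Proof. exact: linearNl. Qed.
Lemma innerNr x y : <|x, - y|> = - <|x, y|>.
Proof. exact: linearNr. Qed.
Lemma innerBl x y z : <|x - y, z|> = <|x, z|> - <|y, z|>.
Proof. exact: linearBl. Qed.
Lemma innerBr x y z : <|z, x - y|> = <|z, x|> - <|z, y|>.
Proof. exact: linearBr. Qed.
Lemma inner_suml (I : Type) (r : seq I) (P : pred I) (F : I -> H) z :
  <|\sum_(i <- r | P i) F i, z|> = \sum_(i <- r | P i) <|F i, z|>.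
Proof. exact: linear_sumlz. Qed.
Lemma inner_sumr (I : Type) (r : seq I) (P : pred I) (F : I -> H) z :
  <|z, \sum_(i <- r | P i) F i|> = \sum_(i <- r | P i) <|z, F i|>.
Proof. exact: linear_sumr. Qed.
Lemma innerC x y : <|x, y|> = Num.conj <|y, x|>.
Proof. by rewrite hermC expr0 mul1r. Qed.
Lemma inner_eq0 x : <|x, x|> = 0 -> x = 0.
Proof. by rewrite -normsqE => /eqP; rewrite expf_eq0 /= normr_eq0 => /eqP. Qed.
Lemma inner_ext x y : (forall z, <|x, z|> = <|y, z|>) -> x = y.
Proof.
move=> xy; apply/eqP; rewrite -subr_eq0; apply/eqP/inner_eq0.
by rewrite innerBl xy subrr.
Qed.

(** Expand the squared norm of x - (<x, y> / <y, y>) y. *)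
Lemma cauchy_schwarz x y : `|<|x, y|>| <= `|x| * `|y|.
Proof.
have [->|y0] := eqVneq y 0; first by rewrite inner0r !normr0 mulr0.
have ny : 0 < `|y| by rewrite normr_gt0.
rewrite -(@ler_pXn2r _ 2) ?nnegrE ?mulr_ge0// exprMn.
have yy : <|y, y|> != 0 by rewrite -normsqE expf_neq0// gt_eqF.
have yyR : Num.conj <|y, y|> = <|y, y|> by rewrite -innerC.
have : 0 <= <|x - (<|x, y|> / <|y, y|>) *: y, x - (<|x, y|> / <|y, y|>) *: y|>.
  by rewrite -normsqE exprn_ge0.
rewrite innerBr innerZr !innerBl !innerZl divfK// subrr mulr0 subr0.
rewrite [<|y, x|>]innerC mulrAC -normCK subr_ge0 -!normsqE.
by rewrite ler_pdivrMr ?exprn_gt0.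
Qed.

End Inner.

Section LinearLemmas.
Context {K : numFieldType} {V W : lmodType K} (f : V -> W) (fl : linear f).
Let fL := GRing.isLinear.Build K V W *:%R f fl.
Let F : {linear V -> W} := HB.pack f fL.
Lemma linD x y : f (x + y) = f x + f y. Proof. exact: (raddfD F). Qed.
Lemma linB x y : f (x - y) = f x - f y. Proof. exact: (raddfB F). Qed.
Lemma lin0 : f 0 = 0. Proof. exact: (raddf0 F). Qed.
Lemma linZ c x : f (c *: x) = c *: f x. Proof. exact: (linearZ_LR F). Qed.
Lemma lin_sum (I : Type) (r : seq I) (P : pred I) (G : I -> V) :
  f (\sum_(i <- r | P i) G i) = \sum_(i <- r | P i) f (G i).
Proof. exact: (raddf_sum F). Qed.
End LinearLemmas.

Section Basis.
Context {R : realType}.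
Local Notation C := (Cplx R).
Context {H : hilbertType R}.
Implicit Types x y z e f : H.

(** The coefficient vanishes off the chosen basis, so that sums can range over
    all vectors, as the sums that define traces do. *)
Definition coef x e : C := if e \in onb H then <|x, e|> else 0.

Lemma onb1 e : e \in onb H -> <|e, e|> = 1 :> C.
Proof. by move=> /set_mem; have [[+ _] _] := onbP H; apply. Qed.

Lemma onb0 e f : e \in onb H -> f \in onb H -> e != f -> <|e, f|> = 0 :> C.
Proof.
by move=> /set_mem eB /set_mem fB /eqP ef; have [[_ +] _] := onbP H; apply.
Qed.

Lemma coef_off x e : e \notin onb H -> coef x e = 0.
Proof. by rewrite /coef => /negPf ->. Qed.

Lemma inner_onb_suml (c : H -> C) (A : {fset H}) f :
  (forall e, e \notin onb H -> c e = 0) -> f \in A -> f \in onb H ->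
  <|\sum_(e <- A) c e *: e, f|> = c f.
Proof.
move=> c0 fA fB; rewrite inner_suml (big_fsetD1 f)//= innerZl onb1// mulr1.
rewrite big_seq big1 ?addr0// => e; rewrite !inE => /andP[ef eA].
have [eB|/c0 ->] := boolP (e \in onb H); last by rewrite innerZl mul0r.
by rewrite innerZl onb0// mulr0.
Qed.

Lemma norm_onb_sum (c : H -> C) (A : {fset H}) :
  (forall e, e \notin onb H -> c e = 0) ->
  `|\sum_(e <- A) c e *: e| ^+ 2 = \sum_(e <- A) `|c e| ^+ 2.
Proof.
move=> c0; rewrite normsqE inner_sumr !big_seq; apply: eq_bigr => f fA.
have [fB|/c0 ->] := boolP (f \in onb H); last first.
  by rewrite normr0 expr0n scale0r inner0r.
by rewrite innerZr -big_seq inner_onb_suml// normCKC.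
Qed.

(** The partial expansion p of x satisfies <x, p> = |p|^2, hence
    |x - p|^2 = |x|^2 - |p|^2. *)
Lemma bessel x (A : {fset H}) : \sum_(e <- A) `|coef x e| ^+ 2 <= `|x| ^+ 2.
Proof.
pose p := \sum_(e <- A) coef x e *: e.
have pE : `|p| ^+ 2 = \sum_(e <- A) `|coef x e| ^+ 2.
  by apply: norm_onb_sum => e; exact: coef_off.
have xp : <|x, p|> = `|p| ^+ 2.
  rewrite pE inner_sumr; apply: eq_bigr => e _; rewrite innerZr normCKC.
  by rewrite /coef; case: ifP => // _; rewrite conjC0 !mul0r.
have : 0 <= `|x - p| ^+ 2 by rewrite exprn_ge0.
rewrite normsqE innerBl !innerBr xp [<|p, x|>]innerC xp -!normsqE.
have -> : Num.conj (`|p| ^+ 2) = `|p| ^+ 2 by rewrite normsqE -innerC.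
by rewrite subrr subr0 subr_ge0 pE.
Qed.

(** Partial sums over disjoint sets are orthogonal, so the tails of the
    series of vectors are controlled by those of the squared coefficients. *)
Lemma onb_sum_exists (c : H -> C) (M : C) :
  (forall e, e \notin onb H -> c e = 0) ->
  (forall A : {fset H}, \sum_(e <- A) `|c e| ^+ 2 <= M) ->
  exists z, is_sum (fun e => c e *: e) z.
Proof.
move=> c0 cM; apply: cauchy_is_sum => e e0.
have [A AP] := nonneg_tail (fun f => exprn_ge0 2 (normr_ge0 (c f))) cM
  (exprn_gt0 2 e0).
exists A => B /AP; rewrite -norm_onb_sum// ler_pXn2r ?nnegrE//; exact: ltW.
Qed.

Lemma inner_bounded y : bounded_operator (fun x : H => <|x, y|> : C).
Proof.
split=> [a x z|]; first by rewrite innerDl innerZl.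
by exists `|y| => x; rewrite mulrC cauchy_schwarz.
Qed.

Lemma is_sum_inner (I : choiceType) (F : I -> H) x y :
  is_sum F x -> is_sum (fun i => <|F i, y|> : C) <|x, y|>.
Proof. exact: (is_sum_map (inner_bounded y)). Qed.

Lemma is_sum_coef (c : H -> C) z f :
  (forall e, e \notin onb H -> c e = 0) ->
  is_sum (fun e => c e *: e) z -> f \in onb H -> <|z, f|> = c f.
Proof.
move=> c0 /(is_sum_inner f) zf fB; apply: (is_sum_unique zf) => e e0.
exists [fset f]%fset => A; rewrite fsub1set => fA.
by rewrite -inner_suml inner_onb_suml// subrr normr0 ltW.
Qed.

Lemma onb_eq0 x : (forall e, e \in onb H -> <|x, e|> = 0 :> C) -> x = 0.
Proof. by move=> xe; have [_] := onbP H; apply => e eB; apply/xe/mem_set. Qed.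

(** The expansion converges by Bessel, and x minus its sum is orthogonal to the
    basis. *)
Lemma onb_expand x : is_sum (fun e => coef x e *: e) x.
Proof.
have [z xz] := @onb_sum_exists (coef x) _ (fun e => @coef_off x e) (bessel x).
suff zx : x = z by rewrite -zx in xz.
apply/eqP; rewrite -subr_eq0; apply/eqP/onb_eq0 => e eB.
rewrite innerBl (is_sum_coef _ xz eB) => [|f]; last exact: coef_off.
by rewrite /coef eB subrr.
Qed.

Lemma parseval x y : is_sum (fun e => coef x e * Num.conj (coef y e)) <|x, y|>.
Proof.
have := is_sum_inner y (onb_expand x).
rewrite (_ : (fun i => _) = fun e => coef x e * Num.conj (coef y e))//.
apply/funext => e; rewrite innerZl /coef; case: ifP => _; last by rewrite !mul0r.
by rewrite [<|e, y|>]innerC.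
Qed.

Lemma parseval_norm x : is_sum (fun e => `|coef x e| ^+ 2) (`|x| ^+ 2).
Proof.
rewrite normsqE; have := parseval x x.
by rewrite (_ : (fun e => _) = fun e => `|coef x e| ^+ 2)//; apply/funext => e; rewrite normCK.
Qed.

(** The vector has coefficients conj (l e).  These are square summable: the
    partial sum p satisfies l p = |p|^2 <= N |p|. *)
Lemma riesz (l : H -> C) M : linear l -> (forall x, `|l x| <= M * `|x|) ->
  exists z, forall x, l x = <|x, z|>.
Proof.
move=> ll lM.
have lb : bounded_operator l by split=> //; exists M.
have [N N0 lN] := bounded_cst_ge0 lb.
pose c e := if e \in onb H then Num.conj (l e) else 0.
have c0 e : e \notin onb H -> c e = 0 by rewrite /c => /negPf ->.
have [|z zc] := @onb_sum_exists c (N ^+ 2) c0.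
  move=> A; rewrite -norm_onb_sum//.
  set p := \sum_(e <- A) _.
  have lp : l p = `|p| ^+ 2.
    rewrite norm_onb_sum// lin_sum//; apply: eq_bigr => e _.
    rewrite (linZ ll) normCK /c; case: ifP => _; last by rewrite conjC0 !mulr0 scale0r.
    by rewrite conjCK.
  have [->|p0] := eqVneq p 0; first by rewrite normr0 expr0n exprn_ge0.
  rewrite ler_pXn2r ?nnegrE//; have := lN p; rewrite lp ger0_norm ?exprn_ge0//.
  by rewrite expr2 ler_pM2r// normr_gt0.
exists z => x; apply: (is_sum_unique (is_sum_map lb (onb_expand x))).
have := parseval x z.
rewrite (_ : (fun e => _ * _) = (fun e => l (coef x e *: e)))//.
apply/funext => e; rewrite (linZ ll) /coef; case: ifP => eB; last first.
  by rewrite mul0r scale0r.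
by rewrite (is_sum_coef c0 zc eB) /c eB conjCK.
Qed.
End Basis.

Section Adjoint.
Context {R : realType} {H1 H2 : hilbertType R}.
Local Notation C := (Cplx R).
Variables (T : H1 -> H2) (Tb : bounded_operator T).

(** The Riesz theorem provides the element which the definition of the adjoint
    selects. *)
Lemma adjointP x y : <|T x, y|> = <|x, adjoint T y|>.
Proof.
have [M M0 TM] := bounded_cst_ge0 Tb.
have [|z|z zP] := @riesz R H1 (fun x => <|T x, y|>) (M * `|y|).
- by move=> a u v; rewrite Tb.1 innerDl innerZl.
- by rewrite (le_trans (cauchy_schwarz _ _))// mulrAC ler_wpM2r.
- rewrite /adjoint; set S := [set _ | _].
  have Sz : S z by [].
  exact: (xgetI 0 Sz).
Qed.

Lemma adjointPl x y : <|adjoint T y, x|> = Num.conj <|T x, y|>.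
Proof. by rewrite innerC -adjointP. Qed.

Lemma adjointPr x y : <|adjoint T y, x|> = <|y, T x|>.
Proof. by rewrite adjointPl -innerC. Qed.

Lemma adjoint_eq (S : H2 -> H1) :
  (forall x y, <|T x, y|> = <|x, S y|>) -> adjoint T = S.
Proof.
move=> TS; apply/funext => y; apply: inner_ext => z.
by rewrite adjointPl TS -innerC.
Qed.

Lemma adjoint_linear : linear (adjoint T).
Proof.
move=> a u v; apply: inner_ext => z; rewrite innerDl innerZl.
by rewrite !adjointPl innerDr innerZr rmorphD rmorphM /= conjCK.
Qed.

Lemma adjoint_le M : 0 <= M -> (forall x, `|T x| <= M * `|x|) ->
  forall y, `|adjoint T y| <= M * `|y|.
Proof.
move=> M0 TM y; have [->|y0] := eqVneq (adjoint T y) 0.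
  by rewrite normr0 mulr_ge0.
have n0 : 0 < `|adjoint T y| by rewrite normr_gt0.
rewrite -(ler_pM2l n0) -expr2 normsqE -adjointP.
have := ger0_norm (_ : 0 <= <|T (adjoint T y), y|>).
rewrite adjointP -normsqE exprn_ge0// => <-//.
rewrite normsqE -adjointP (le_trans (cauchy_schwarz _ _))// mulrA.
by rewrite ler_wpM2r// mulrC.
Qed.
End Adjoint.

(** * Positive operators and Cholesky elimination *)

Section PositiveOperators.
Context {R : realType}.
Local Notation C := (Cplx R).
Context {H : hilbertType R}.
Implicit Types x y z : H.

(** Polarization: on x + y it gives Q(y, x) + Q(x, y) = 0, and on ix + y it
    gives Q(x, y) = Q(y, x). *)
Lemma sesqui_eq0 (Q : H -> H -> C) :
  (forall a x y z, Q (a *: x + y) z = a * Q x z + Q y z) ->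
  (forall a x y z, Q z (a *: x + y) = Num.conj a * Q z x + Q z y) ->
  (forall x, Q x x = 0) -> forall x y, Q x y = 0.
Proof.
move=> Ql Qr Q0 x y.
have h1 : Q y x + Q x y = 0.
  by have := Q0 (1 *: x + y); rewrite Ql !Qr !Q0 conjC1 !mul1r add0r addr0 addrC.
have h2 : - 'i * Q y x + 'i * Q x y = 0.
  have := Q0 ('i *: x + y); rewrite Ql !Qr !Q0 conjCi mulr0 add0r addr0.
  by rewrite addrC.
have : 'i * (Q x y - Q y x) = 0 by rewrite mulrBr addrC -mulNr.
move/eqP; rewrite mulf_eq0 (negPf (neq0Ci C)) /= subr_eq0 => /eqP e.
move: h1; rewrite e -mulr2n => /eqP; rewrite mulrn_eq0 /= => /eqP //.
Qed.

Variables (P : H -> H) (Ppos : positive_op P).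

Lemma pos_linear : linear P. Proof. exact: Ppos.1.1. Qed.

Lemma pos_ge0 x : 0 <= <|P x, x|>. Proof. exact: Ppos.2. Qed.

Lemma pos_selfadj x y : <|P x, y|> = <|x, P y|>.
Proof.
apply/eqP; rewrite -subr_eq0; apply/eqP.
apply: (@sesqui_eq0 (fun x y => <|P x, y|> - <|x, P y|>)) => [a u v w|a u v w|u].
- by rewrite pos_linear !innerDl !innerZl mulrBr opprD addrACA.
- by rewrite pos_linear !innerDr !innerZr mulrBr opprD addrACA.
- apply/eqP; rewrite subr_eq0 [<|u, _|>]innerC; apply/eqP/esym/CrealP.
  exact/ger0_real/pos_ge0.
Qed.

Lemma pos_conj x y : <|P x, y|> = Num.conj <|P y, x|>.
Proof. by rewrite pos_selfadj innerC. Qed.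

(** The usual argument works as soon as one of the two diagonal values is
    nonzero.  If both vanish, the form is nonpositive at x - c y for
    c = <P x, y>, which forces c = 0. *)
Lemma pos_cs x y : `|<|P x, y|>| ^+ 2 <= <|P x, x|> * <|P y, y|>.
Proof.
have key (u v : H) : 0 < <|P v, v|> ->
    `|<|P u, v|>| ^+ 2 <= <|P u, u|> * <|P v, v|>.
  move=> q0; have := pos_ge0 (u - (<|P u, v|> / <|P v, v|>) *: v).
  have qR : Num.conj <|P v, v|> = <|P v, v|> by apply/CrealP/ger0_real/ltW.
  rewrite (linB pos_linear) (linZ pos_linear) innerBr innerZr !innerBl !innerZl.
  rewrite divfK ?gt_eqF// subrr mulr0 subr0 [<|P v, u|>]pos_conj.
  by rewrite mulrAC -normCK subr_ge0 ler_pdivrMr.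
have [y0|y0] := eqVneq <|P y, y|> 0; last first.
  by apply: key; rewrite lt_def y0 pos_ge0.
have [x0|x0] := eqVneq <|P x, x|> 0; last first.
  rewrite pos_conj norm_conjC mulrC; apply: key.
  by rewrite lt_def x0 pos_ge0.
suff -> : <|P x, y|> = 0 by rewrite normr0 expr0n mulr_ge0// pos_ge0.
set c := <|P x, y|>; have := pos_ge0 (x - c *: y).
rewrite (linB pos_linear) (linZ pos_linear) innerBr innerZr !innerBl !innerZl.
rewrite x0 y0 mulr0 subr0 sub0r [<|P y, x|>]pos_conj -/c.
rewrite [Num.conj c * c]mulrC -opprD oppr_ge0 -normCK -mulr2n => h.
have : `|c| ^+ 2 *+ 2 == 0 by rewrite eq_le h mulrn_wge0// exprn_ge0.
by rewrite mulrn_eq0 /= expf_eq0 /= normr_eq0 => /eqP.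
Qed.

Lemma pos_eq0 x : <|P x, x|> = 0 -> P x = 0.
Proof.
move=> x0; apply: inner_eq0; have := pos_cs x (P x); rewrite x0 mul0r => h.
have : `|<|P x, P x|>| ^+ 2 == 0 by rewrite eq_le h exprn_ge0.
by rewrite expf_eq0 /= normr_eq0 => /eqP.
Qed.
End PositiveOperators.

Section Elimination.
Context {R : realType}.
Local Notation C := (Cplx R).
Context {H W : hilbertType R}.

(** This is the relation between t and |t|, without reference to the adjoint
    of t; it is stable under the elimination below. *)
Definition same_norm (t : H -> W) (P : H -> H) :=
  [/\ linear t, positive_op P & forall x, `|t x| = `|P x|].

Lemma same_norm_bounded t P : same_norm t P -> bounded_operator t.
Proof.
move=> [tl Pp tP]; split=> //; have [_ [M PM]] := Pp.1.
by exists M => x; rewrite tP.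
Qed.

(** One step of elimination, on the vector y.  With c x = x - (<P x, y> / q) y
    and q = <P y, y>, take t' = t c and P' = P c.  Both keep the relation of
    equal norms because they are composed with the same map.  The form of P'
    is that of P minus |<P x, y>|^2 / q, which is nonnegative by the
    Cauchy-Schwarz inequality of P. *)
Lemma eliminate (t : H -> W) P (y : H) : same_norm t P -> <|P y, y|> != 0 ->
  exists p w t' P', [/\ same_norm t' P', `|w| = `|p|, P' y = 0,
    forall x, t x = <|x, p|> *: w + t' x &
    forall x, <|P x, x|> = `|<|x, p|>| ^+ 2 + <|P' x, x|>].
Proof.
move=> tP; have [tl Pp tPn] := tP; set q := <|P y, y|> => qn0.
have q0 : 0 < q by rewrite lt_def qn0; exact: pos_ge0.
have Pl := pos_linear Pp.
have sq0 : 0 < sqrtC q by rewrite sqrtC_gt0.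
have sqR : Num.conj (sqrtC q)^-1 = (sqrtC q)^-1.
  by apply/CrealP/ger0_real; rewrite invr_ge0 ltW.
have sqq : (sqrtC q)^-1 * (sqrtC q)^-1 = q^-1 by rewrite -invfM -expr2 sqrtCK.
pose c x := x - (<|P x, y|> / q) *: y.
have cl : linear c.
  move=> a u v; rewrite /c Pl innerDl innerZl mulrDl scalerDl -mulrA -scalerA.
  by rewrite scalerBr opprD addrACA.
pose p := (sqrtC q)^-1 *: P y; pose w := (sqrtC q)^-1 *: t y.
have pE x : <|x, p|> = (sqrtC q)^-1 * <|P x, y|>.
  by rewrite innerZr sqR (pos_selfadj Pp).
have PcE x : P (c x) = P x - <|x, p|> *: p.
  by rewrite (linB Pl) (linZ Pl) pE scalerA mulrAC sqq mulrC.
have P'E x : <|P x, x|> = `|<|x, p|>| ^+ 2 + <|P (c x), x|>.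
  by rewrite PcE innerBl innerZl [<|p, x|>]innerC -normCK addrC subrK.
have P'pos : positive_op (P \o c).
  have tc : linear (P \o c) by move=> a u v; rewrite /= cl Pl.
  have [M M0 PM] := bounded_cst_ge0 Pp.1.
  split=> [|x].
    split=> //; exists (M + `|p| * `|p|) => x; rewrite /= PcE.
    rewrite (le_trans (ler_normB _ _))// mulrDl lerD// normrZ mulrAC.
    by rewrite ler_wpM2r// mulrC cauchy_schwarz.
  have -> : <|(P \o c) x, x|> = <|P x, x|> - `|<|x, p|>| ^+ 2.
    by rewrite P'E addrC addKr.
  rewrite subr_ge0 pE normrM exprMn gtr0_norm ?invr_gt0// expr2 sqq mulrC.
  by rewrite ler_pdivrMr//; exact: pos_cs.
exists p, w, (t \o c), (P \o c); split=> //.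
- by split=> // [a u v|x]; rewrite /= ?tPn// cl tl.
- by rewrite !normrZ tPn.
- by rewrite /= /c divff// scale1r subrr (lin0 Pl).
- move=> x; rewrite /= (linB tl) (linZ tl) pE scalerA mulrAC sqq mulrC.
  by rewrite addrC subrK.
Qed.

(** Eliminating the vectors of [ys] one after the other.  A vector that P
    annihilates is annihilated for ever after, since the forms decrease; a
    vector y with <P y, y> = 0 is already annihilated. *)
Lemma elimination_ind (Q : (H -> W) -> (H -> H) -> Prop) (ys : seq H) :
  (forall t P, same_norm t P -> (forall y, y \in ys -> P y = 0) -> Q t P) ->
  (forall t P p w t' P', same_norm t P -> same_norm t' P' -> `|w| = `|p| ->
     (forall x, t x = <|x, p|> *: w + t' x) ->
     (forall x, <|P x, x|> = `|<|x, p|>| ^+ 2 + <|P' x, x|>) ->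
     Q t' P' -> Q t P) ->
  forall t P, same_norm t P -> Q t P.
Proof.
move=> base step.
suff main (zs : seq H) t P : same_norm t P ->
    (forall y, y \in ys -> y \notin zs -> P y = 0) -> Q t P.
  by move=> t P tP; apply: (main ys) => // y ->.
elim: zs t P => [|z zs IH] t P tP Pys.
  by apply: base => // y yys; exact: Pys.
have [_ Pp _] := tP.
have [z0|zn0] := eqVneq <|P z, z|> 0.
  apply: IH => // y yys yzs; have [->|yz] := eqVneq y z; first exact: pos_eq0 z0.
  by apply: Pys => //; rewrite in_cons negb_or yz.
have [p [w [t' [P' [tP' wp P'z tE PE]]]]] := eliminate tP zn0.
apply: (step _ _ _ _ _ _ tP tP' wp tE PE); apply: IH => // y yys yzs.
have [->//|yz] := eqVneq y z.
have [_ Pp' _] := tP'; apply: (pos_eq0 Pp').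
apply/eqP; rewrite eq_le (pos_ge0 Pp') andbT.
have Py : P y = 0 by apply: Pys => //; rewrite in_cons negb_or yz.
have -> : (0 : C) = <|P y, y|> by rewrite Py inner0l.
by rewrite PE lerDr exprn_ge0.
Qed.

(** The steps of the elimination collected: the pairs in [L] give the rank-one
    terms by which t exceeds t', and the first components those by which P
    exceeds P'. *)
Lemma cholesky (ys : seq H) (t : H -> W) P : same_norm t P ->
  exists (L : seq (H * W)) t' P', [/\ same_norm t' P',
    forall l, l \in L -> `|l.2| = `|l.1|,
    forall y, y \in ys -> P' y = 0,
    forall x, t x = \sum_(l <- L) <|x, l.1|> *: l.2 + t' x &
    forall x, <|P x, x|> = \sum_(l <- L) `|<|x, l.1|>| ^+ 2 + <|P' x, x|>].
Proof.
move: t P; apply: (elimination_ind (ys := ys)) => [t P tP Pys|].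
  by exists [::], t, P; split=> // x; rewrite big_nil add0r.
move=> t P p w t1 P1 _ _ wp tE1 PE1 [L [t' [P' [tP' Ln Pys tE PE]]]].
exists ((p, w) :: L), t', P'; split=> // [l|x|x].
- by rewrite in_cons => /orP[/eqP->|/Ln].
- by rewrite big_cons tE1 tE addrA.
- by rewrite big_cons PE1 PE addrA.
Qed.
End Elimination.

(** * Traces and trace norms *)

(** Divide by u and v, and use 2 x y <= x^2 + y^2 in each term. *)
Lemma finite_cauchy_schwarz (K : numFieldType) (I : Type) (r : seq I)
    (a b : I -> K) (u v : K) :
  (forall i, 0 <= a i) -> (forall i, 0 <= b i) -> 0 <= u -> 0 <= v ->
  \sum_(i <- r) a i ^+ 2 <= u ^+ 2 -> \sum_(i <- r) b i ^+ 2 <= v ^+ 2 ->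
  \sum_(i <- r) a i * b i <= u * v.
Proof.
move=> a0 b0 u0 v0 au bv.
have zero (c d : I -> K) : (forall i, 0 <= c i) ->
    \sum_(i <- r) c i ^+ 2 <= 0 -> \sum_(i <- r) c i * d i = 0.
  move=> c0; elim: r {au bv} => [|i r IH]; first by rewrite !big_nil.
  rewrite !big_cons => h.
  have s0 : 0 <= \sum_(j <- r) c j ^+ 2 by apply: sumr_ge0 => j _; rewrite exprn_ge0.
  rewrite IH ?addr0; last by apply: le_trans h; rewrite lerDr exprn_ge0.
  have : c i ^+ 2 == 0.
    by rewrite eq_le exprn_ge0// andbT (le_trans _ h)// lerDl.
  by rewrite expf_eq0 /= => /eqP ->; rewrite mul0r.
have [u00|un0] := eqVneq u 0.
  by rewrite u00 expr0n in au *; rewrite mul0r zero.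
have [v00|vn0] := eqVneq v 0.
  rewrite v00 expr0n in bv *; rewrite mulr0.
  by under eq_bigr do rewrite mulrC; rewrite zero.
have up : 0 < u by rewrite lt_def un0.
have vp : 0 < v by rewrite lt_def vn0.
rewrite -[leRHS]mulr1 -ler_pdivrMl ?mulr_gt0// mulr_sumr.
apply: (@le_trans _ _ (\sum_(i <- r) ((a i / u) ^+ 2 + (b i / v) ^+ 2) / 2)).
  apply: ler_sum => i _; rewrite ler_pdivlMr//.
  have -> : (u * v)^-1 * (a i * b i) * 2 = (a i / u) * (b i / v) *+ 2.
    by rewrite -[RHS]mulr_natr invfM mulrACA; congr (_ * _ * _); rewrite mulrC.
  have : 0 <= (a i / u - b i / v) ^+ 2.
    have rel : a i / u - b i / v \is Num.real.
      by rewrite rpredB// ger0_real// divr_ge0.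
    by rewrite -real_normK// exprn_ge0.
  by rewrite sqrrB addrAC subr_ge0.
rewrite -mulr_suml big_split /=.
have -> : \sum_(i <- r) (a i / u) ^+ 2 = (\sum_(i <- r) a i ^+ 2) / u ^+ 2.
  by rewrite mulr_suml; apply: eq_bigr => i _; rewrite expr_div_n.
have -> : \sum_(i <- r) (b i / v) ^+ 2 = (\sum_(i <- r) b i ^+ 2) / v ^+ 2.
  by rewrite mulr_suml; apply: eq_bigr => i _; rewrite expr_div_n.
rewrite ler_pdivrMr// mul1r -[2]/(1 + 1) lerD//.
  by rewrite ler_pdivrMr ?exprn_gt0// mul1r.
by rewrite ler_pdivrMr ?exprn_gt0// mul1r.
Qed.

Section TraceBounds.
Context {R : realType}.
Local Notation C := (Cplx R).

(** The trace of an operator is a limit that need not exist; additivity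
    requires this relational form. *)
Definition has_trace {H : hilbertType R} (T : H -> H) (l : C) := is_sum (diag T) l.

Lemma has_traceE (H : hilbertType R) (T : H -> H) l : has_trace T l -> trace T = l.
Proof. exact: sum_is_sum. Qed.

Lemma diagE (H : hilbertType R) (T : H -> H) e : diag T e = coef (T e) e.
Proof. by []. Qed.

Lemma has_traceD (H : hilbertType R) (S T : H -> H) l m :
  has_trace S l -> has_trace T m -> has_trace (fun x => S x + T x) (l + m).
Proof.
move=> Sl Tm; apply: eq_is_sum (is_sumD Sl Tm) => e.
by rewrite /diag innerDl; case: ifP => // _; rewrite addr0.
Qed.

Lemma has_trace_rank1 (H : hilbertType R) (u v : H) :
  has_trace (fun z => <|z, u|> *: v) <|v, u|>.
Proof.
apply: eq_is_sum (parseval v u) => e; rewrite /diag /coef; case: ifP => _; last by rewrite mul0r.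
by rewrite innerZl -innerC mulrC.
Qed.

Lemma diag_ge0 (H : hilbertType R) (P : H -> H) e : positive_op P -> 0 <= diag P e.
Proof. by move=> Pp; rewrite /diag; case: ifP => // _; exact: pos_ge0. Qed.

(** By Parseval the left-hand side is the sum over the basis of a family that is
    dominated by the diagonal of P. *)
Lemma sum_coef_norm (H W : hilbertType R) (L : seq (H * W)) (P : H -> H) (tau : C) :
  (forall A : {fset H}, \sum_(e <- A) diag P e <= tau) ->
  (forall x, \sum_(l <- L) `|<|x, l.1|>| ^+ 2 <= <|P x, x|>) ->
  \sum_(l <- L) `|l.1| ^+ 2 <= tau.
Proof.
move=> Ptau LP.
have Ls : is_sum (fun e => \sum_(l <- L) `|coef l.1 e| ^+ 2) (\sum_(l <- L) `|l.1| ^+ 2).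
  elim: L {LP} => [|l L IH].
    rewrite big_nil; apply: eq_is_sum (is_sum_0 _) => e.
    by rewrite big_nil.
  rewrite big_cons; apply: eq_is_sum (is_sumD (parseval_norm l.1) IH) => e.
  by rewrite big_cons.
apply: (is_sum_le _ Ls) => [e|A].
  by apply: sumr_ge0 => l _; rewrite exprn_ge0.
apply: le_trans (Ptau A); apply: ler_sum => e _; rewrite diagE /coef.
case: ifP => eB; last by rewrite big1// => l _; rewrite normr0 expr0n.
apply: le_trans (LP e); apply: ler_sum => l _.
by rewrite [<|l.1, e|>]innerC norm_conjC.
Qed.

(** For finitely many basis vectors z, eliminate the vectors D z: on these t is
    the sum of the rank-one terms |w><p| alone, with |w| = |p|.  Bessel bounds
    the contribution of |B w><D' p| by |B w| |D' p| <= M |p|^2, and the sum of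
    the |p|^2 is at most the trace of P.  The maps B and D are there to treat
    operators transported to another space together with products. *)
Lemma trace_bound (H W W' : hilbertType R) (t : H -> W) (P : H -> H) (tau M : C)
    (B : W -> W') (D : W' -> H) (D' : H -> W') :
  same_norm t P -> (forall A : {fset H}, \sum_(e <- A) diag P e <= tau) ->
  linear B -> 0 <= M -> (forall w, `|B w| <= M * `|w|) ->
  (forall z x, <|D z, x|> = <|z, D' x|>) -> (forall x, `|D' x| <= `|x|) ->
  exists2 l, has_trace (B \o t \o D) l & `|l| <= M * tau.
Proof.
move=> tP Ptau Bl M0 BM DD' D'1.
apply: (@abs_is_sum R W' (cline R)) => F.
have [L [t' [P' [tP' Ln P'y tE PE]]]] := cholesky [seq D z | z <- F] tP.
have [_ Pp' t'P'] := tP'.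
have Ltau : \sum_(l <- L) `|l.1| ^+ 2 <= tau.
  by apply: (sum_coef_norm Ptau) => x; rewrite PE lerDl pos_ge0.
apply: le_trans (ler_wpM2l M0 Ltau).
have le1 z : z \in F -> `|diag (B \o t \o D) z| <=
    \sum_(l <- L) `|coef (D' l.1) z| * `|coef (B l.2) z|.
  move=> zF; rewrite /diag /coef; case: ifP => zB; last first.
    by rewrite normr0; apply: sumr_ge0 => l _; rewrite mulr_ge0.
  have -> : (B \o t \o D) z = \sum_(l <- L) <|D z, l.1|> *: B l.2.
    have t'0 : t' (D z) = 0.
      by apply/normr0_eq0; rewrite t'P' P'y ?map_f// normr0.
    by rewrite /= tE t'0 addr0 (lin_sum Bl); apply: eq_bigr => l _; rewrite (linZ Bl).
  rewrite inner_suml (le_trans (ler_norm_sum _ _ _))//.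
  apply: ler_sum => l _; rewrite innerZl normrM DD' [<|z, _|>]innerC norm_conjC.
  by [].
apply: (@le_trans _ _ (\sum_(z <- F) \sum_(l <- L) `|coef (D' l.1) z| * `|coef (B l.2) z|)).
  by rewrite big_seq [leRHS]big_seq; apply: ler_sum.
rewrite exchange_big /= mulr_sumr big_seq [leRHS]big_seq; apply: ler_sum => l lL.
apply: (@le_trans _ _ (`|D' l.1| * `|B l.2|)).
  by apply: finite_cauchy_schwarz => //; exact: bessel.
rewrite expr2 mulrCA ler_pM//.
by rewrite (le_trans (BM _))// Ln.
Qed.

Lemma norm_inner (H1 H2 : hilbertType R) (x : H1) (y : H2) :
  <|x, x|> = <|y, y|> -> `|x| = `|y|.
Proof.
move=> xy; apply/eqP; rewrite -(@eqrXn2 _ 2) ?normr_ge0//.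
by rewrite !normsqE xy.
Qed.

Lemma is_abs_same_norm (H : hilbertType R) (T P : H -> H) :
  bounded_operator T -> is_abs T P -> same_norm T P.
Proof.
move=> Tb [Pp PT]; split=> // [|x]; first exact: Tb.1.
apply: norm_inner; rewrite (adjointP Tb) (pos_selfadj Pp).
by have := congr1 (fun f => f x) PT => /= ->.
Qed.

Lemma same_norm_is_abs (H : hilbertType R) (T P : H -> H) :
  same_norm T P -> is_abs T P.
Proof.
move=> TP; have [Tl Pp TPn] := TP; have Tb := same_norm_bounded TP.
split=> //; apply/funext => x; apply: inner_ext => z.
rewrite /= (adjointPl Tb) [<|P (P x), z|>]innerC -(pos_selfadj Pp).
congr Num.conj; apply/eqP; rewrite -subr_eq0; apply/eqP.
apply: (@sesqui_eq0 _ _ (fun z x => <|P z, P x|> - <|T z, T x|>)) => [a u v w|a u v w|u].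
- by rewrite Tl (pos_linear Pp) !innerDl !innerZl mulrBr opprD addrACA.
- by rewrite Tl (pos_linear Pp) !innerDr !innerZr mulrBr opprD addrACA.
- by rewrite -!normsqE TPn subrr.
Qed.

Lemma id_bound (H : hilbertType R) (w : H) : `|w| <= 1 * `|w|.
Proof. by rewrite mul1r. Qed.

(** The definitions choose some positive square root of T^* T.  Its trace is at
    most that of P by [trace_bound], whichever root was chosen, because all
    these roots Q satisfy |Q x| = |T x| = |P x|. *)
Lemma trace_norm_le (H : hilbertType R) (T P : H -> H) tau :
  same_norm T P -> (forall A : {fset H}, \sum_(e <- A) diag P e <= tau) ->
  [/\ trace_class T, same_norm T (abs_op T), has_trace (abs_op T) (trace_norm T) &
      trace_norm T <= tau].
Proof.
move=> TP Ptau; have Tb := same_norm_bounded TP.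
have absP := same_norm_is_abs TP.
have absT : is_abs T (abs_op T) by exact: (xgetI (fun=> 0) absP).
have Tabs := is_abs_same_norm Tb absT.
have abssn : same_norm (abs_op T) P.
  have [_ Pp TPn] := TP; have [_ ap Ta] := Tabs.
  by split=> // [|x]; [exact: pos_linear ap|rewrite -Ta TPn].
have [l lt ltau] := @trace_bound H H H _ P tau 1 id id id abssn Ptau
  (fun _ _ _ => erefl) ler01 (@id_bound H) (fun _ _ => erefl) (fun _ => lexx _).
have lE : trace_norm T = l by exact: has_traceE lt.
split=> //.
- by split=> //; exists P => //; exists tau => A; rewrite partial_sumE.
- by rewrite lE.
rewrite lE (le_trans _ (_ : `|l| <= _))//; last by move: ltau; rewrite mul1r.
rewrite ger0_norm//; apply: (is_sum_ge0 _ lt) => e; apply: diag_ge0.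
by have [_ ap _] := Tabs.
Qed.

Lemma trace_class_spec (H : hilbertType R) (T : H -> H) : trace_class T ->
  same_norm T (abs_op T) /\ has_trace (abs_op T) (trace_norm T).
Proof.
move=> [Tb [P absP [M PM]]].
have [|_ ? ? _] := trace_norm_le (is_abs_same_norm Tb absP) (tau := M) => //.
by move=> A; rewrite -partial_sumE.
Qed.

Lemma trace_class_bound (H W' : hilbertType R) (T : H -> H) (M : C)
    (B : H -> W') (D : W' -> H) (D' : H -> W') :
  trace_class T -> linear B -> 0 <= M -> (forall w, `|B w| <= M * `|w|) ->
  (forall z x, <|D z, x|> = <|z, D' x|>) -> (forall x, `|D' x| <= `|x|) ->
  exists2 l, has_trace (B \o T \o D) l & `|l| <= M * trace_norm T.
Proof.
move=> /trace_class_spec[Tabs Ttr]; apply: (trace_bound Tabs) => A.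
apply: (fsum_le_is_sum _ _ Ttr) => e; apply: diag_ge0.
by have [_ ap _] := Tabs.
Qed.

Lemma rank1_linear (H W : hilbertType R) (p : H) (w : W) :
  linear (fun z => <|z, p|> *: w).
Proof. by move=> a u v; rewrite innerDl innerZl scalerDl scalerA. Qed.

Lemma rank1_pos (H : hilbertType R) (p : H) :
  positive_op (fun z => <|z, p|> *: p).
Proof.
split=> [|x]; last by rewrite innerZl [<|p, x|>]innerC -normCK exprn_ge0.
split; first exact: rank1_linear.
exists (`|p| * `|p|) => x; rewrite normrZ mulrAC ler_wpM2r// mulrC.
exact: cauchy_schwarz.
Qed.

(** The absolute value of |w><p| is the multiple (|w| / |p|) |p><p|. *)
Lemma rank1_trace_class (H : hilbertType R) (p w : H) :
  trace_class (fun z => <|z, p|> *: w).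
Proof.
have [->|p0] := eqVneq p 0.
  have e0 : (fun z : H => <|z, 0|> *: w) = (fun z : H => <|z, 0|> *: (0 : H)).
    by apply/funext => z; rewrite inner0r !scale0r.
  rewrite e0; have sn : same_norm (fun z : H => <|z, 0|> *: (0 : H)) (fun z => <|z, 0|> *: 0).
    split; [exact: rank1_linear|exact: rank1_pos|move=> x; reflexivity].
  have [|] := trace_norm_le sn (tau := 0) => // A.
  by rewrite big1// => e _; rewrite /diag; case: ifP => // _; rewrite scaler0 inner0l.
have np : 0 < `|p| by rewrite normr_gt0.
pose c := `|w| / `|p|.
have c0 : 0 <= c by rewrite divr_ge0.
pose P (z : H) := c *: (<|z, p|> *: p).
have [rb rp] := rank1_pos p.
have Pp : positive_op P.
  split=> [|x]; last by rewrite innerZl mulr_ge0.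
  split=> [a u v|]; first by rewrite /P rb.1 scalerDr scalerA mulrC -scalerA.
  have [_ [M rM]] := rb; exists (c * M) => x.
  by rewrite normrZ ger0_norm// -mulrA ler_wpM2l.
have sn : same_norm (fun z : H => <|z, p|> *: w) P.
  split=> // [|x]; first exact: rank1_linear.
  rewrite /P normrZ [RHS]normrZ (ger0_norm c0) (normrZ _ p) mulrCA; congr (_ * _).
  by rewrite /c divfK// gt_eqF.
have ht : has_trace P (c * <|p, p|>).
  have -> : P = fun z => <|z, p|> *: (c *: p).
    by apply/funext => z; rewrite /P !scalerA mulrC.
  by rewrite -innerZl; exact: has_trace_rank1.
have [|] := trace_norm_le sn (tau := c * <|p, p|>) => // A.
by apply: (fsum_le_is_sum _ _ ht) => e; exact: diag_ge0.
Qed.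

(** Choose a finite part of the basis outside of which the diagonal of |T| sums
    up to at most eps, and eliminate these vectors.  The rest has trace norm at
    most eps and the same [gap] as T.  The steps are followed one by one: each
    intermediate rest comes with its absolute value and is therefore of trace
    class, without an appeal to sums of trace class operators. *)
Lemma trace_class_density (H : hilbertType R) (gap : (H -> H) -> C) (M : C) :
  (forall p w T, trace_class T -> trace_class (fun x => <|x, p|> *: w + T x) ->
     gap (fun x => <|x, p|> *: w + T x) = gap T) ->
  0 <= M -> (forall T, trace_class T -> `|gap T| <= M * trace_norm T) ->
  forall T, trace_class T -> gap T = 0.
Proof.
move=> gapD M0 gapM T0 T0tc; have [sn0 tr0] := trace_class_spec T0tc.
set P0 := abs_op T0 in sn0 tr0; have [_ P0p _] := sn0.
have P0ge e : 0 <= diag P0 e by exact: diag_ge0.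
have P0le A := fsum_le_is_sum P0ge A tr0.
suff small eps : 0 < eps -> `|gap T0| <= M * eps.
  apply/normr0_eq0/eqP; rewrite eq_le normr_ge0 andbT.
  apply/ler_addgt0Pr => e e0; rewrite add0r.
  have M1 : 0 < M + 1 by rewrite ltr_wpDl.
  apply: (le_trans (small (e / (M + 1)) _)); first exact: divr_gt0.
  by rewrite mulrCA ler_piMr ?(ltW e0)// ler_pdivrMr// mul1r lerDl.
move=> eps0; have [A AP] := nonneg_tail P0ge P0le eps0.
have tcl T P : same_norm T P -> (forall e, diag P e <= diag P0 e) -> trace_class T.
  move=> TP PP0; have [|] := trace_norm_le TP (tau := trace_norm T0) => // B.
  by apply: le_trans (P0le B); exact: ler_sum.
have main : forall T P, same_norm T P -> (forall e, diag P e <= diag P0 e) ->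
    exists T1 P1, [/\ same_norm T1 P1, forall e, diag P1 e <= diag P0 e,
      forall y, y \in enum_fset A -> P1 y = 0 & gap T = gap T1].
  apply: (elimination_ind (ys := enum_fset A)) => [T P TP Py PP0|].
    by exists T, P.
  move=> T P p w T' P' TP TP' _ TE PE IH PP0.
  have P'P0 e : diag P' e <= diag P0 e.
    apply: le_trans (PP0 e); rewrite /diag; case: ifP => // _.
    by rewrite PE lerDr exprn_ge0.
  have [T1 [P1 [? ? ? gE]]] := IH P'P0; exists T1, P1; split=> //.
  have TEx : T = fun x => <|x, p|> *: w + T' x by exact/funext.
  rewrite TEx gapD//; first exact: tcl TP' _.
  by rewrite -TEx; exact: tcl TP PP0.
have [T [P [TP PP0 Py gE]]] := main _ _ sn0 (fun=> lexx _).
have [|Ttc _ _ Tn] := trace_norm_le TP (tau := eps).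
  move=> B; rewrite (fsum_split _ (fsubsetIl B A)).
  have -> : \sum_(e <- (B `&` A)%fset) diag P e = 0.
    rewrite big_seq big1// => e; rewrite inE => /andP[_ eA].
    by rewrite /diag Py// inner0l; case: ifP.
  rewrite add0r; apply: le_trans (AP (B `\` (B `&` A))%fset _).
    exact: ler_sum.
  by apply/fdisjointP => e eA; rewrite !inE eA andbT andNb.
by rewrite gE (le_trans (gapM _ Ttc))// ler_wpM2l.
Qed.
End TraceBounds.

(** * Square-summable families of vectors *)

Section L2.
Context {R : realType}.
Local Notation C := (Cplx R).
Context {I : choiceType} {H : hilbertType R}.

(** The norm on l2 is the supremum of these seminorms, one for each finite set
    of coordinates. *)
Definition l2_norm (A : {fset I}) (f : I -> H) : C :=
  sqrtC (\sum_(i <- A) `|f i| ^+ 2).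

Lemma sqsum_ge0 (A : {fset I}) (f : I -> H) : 0 <= \sum_(i <- A) `|f i| ^+ 2.
Proof. by apply: sumr_ge0 => i _; rewrite exprn_ge0. Qed.

Lemma l2_norm_sqr (A : {fset I}) (f : I -> H) : l2_norm A f ^+ 2 = \sum_(i <- A) `|f i| ^+ 2.
Proof. exact: sqrtCK. Qed.

Lemma l2_norm_ge0 (A : {fset I}) (f : I -> H) : 0 <= l2_norm A f.
Proof. by rewrite sqrtC_ge0 sqsum_ge0. Qed.

Lemma l2_norm_le (A : {fset I}) (f : I -> H) M : 0 <= M -> \sum_(i <- A) `|f i| ^+ 2 <= M ^+ 2 ->
  l2_norm A f <= M.
Proof. by move=> M0; rewrite -l2_norm_sqr ler_pXn2r ?nnegrE ?l2_norm_ge0. Qed.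

Lemma l2_normD (A : {fset I}) (f g : I -> H) : l2_norm A (f + g) <= l2_norm A f + l2_norm A g.
Proof.
apply: l2_norm_le; first by rewrite addr_ge0 ?l2_norm_ge0.
apply: (@le_trans _ _ (\sum_(i <- A) (`|f i| + `|g i|) ^+ 2)).
  by apply: ler_sum => i _; rewrite lerXn2r ?nnegrE ?addr_ge0// ler_normD.
under eq_bigr do rewrite sqrrD; rewrite sqrrD !big_split /= !l2_norm_sqr.
rewrite lerD2r lerD2l [leRHS]mulr2n.
by apply: lerD; apply: finite_cauchy_schwarz; rewrite ?l2_norm_ge0 ?l2_norm_sqr.
Qed.

Lemma l2_normZ (A : {fset I}) c (f : I -> H) : l2_norm A (c *: f) = `|c| * l2_norm A f.
Proof.
apply/eqP; rewrite -(@eqrXn2 _ 2) ?mulr_ge0 ?l2_norm_ge0//.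
rewrite exprMn !l2_norm_sqr mulr_sumr; apply/eqP/eq_bigr => i _.
by rewrite normrZ exprMn.
Qed.

Lemma l2_norm_coord i : exists A, forall f, `|f i| <= l2_norm A f.
Proof.
exists [fset i]%fset => f.
by rewrite /l2_norm big_seq_fset1 sqrCK.
Qed.

Lemma l2_norm_fin (A : {fset I}) : exists s : seq I, forall f, l2_norm A f <= \sum_(i <- s) `|f i|.
Proof.
exists (enum_fset A) => f.
have s0 : 0 <= \sum_(i <- A) `|f i| by apply: sumr_ge0.
apply: l2_norm_le => //; rewrite expr2 mulr_suml big_seq [leRHS]big_seq.
apply: ler_sum => i iA; rewrite expr2 ler_wpM2l// (big_fsetD1 i)//= lerDl.
by apply: sumr_ge0.
Qed.

Definition l2_seminorms : seminorms I H :=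
  Seminorms l2_norm_ge0 l2_normD l2_normZ l2_norm_coord l2_norm_fin.

Definition l2 := bfam l2_seminorms (@complex_lub R).
HB.instance Definition _ := CompleteNormedModule.on l2.
Implicit Types f g : l2.

Lemma l2_ext f g : (forall i, f i = g i) -> f = g.
Proof. exact: bfam_ext. Qed.

Lemma l2_partial f (A : {fset I}) : \sum_(i <- A) `|f i| ^+ 2 <= `|f| ^+ 2.
Proof.
rewrite -l2_norm_sqr lerXn2r ?nnegrE ?l2_norm_ge0//.
exact: (sn_le_norm (p := l2_seminorms) f A).
Qed.

Lemma l2_le f M : 0 <= M -> (forall A : {fset I}, \sum_(i <- A) `|f i| ^+ 2 <= M ^+ 2) ->
  `|f| <= M.
Proof.
move=> M0 fM; apply: (@bfam_norm_le _ _ _ _ l2_seminorms f M) => // A.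
exact: l2_norm_le.
Qed.

Lemma l2_bounded (f : I -> H) M :
  (forall A : {fset I}, \sum_(i <- A) `|f i| ^+ 2 <= M) ->
  f \in bounded_family l2_seminorms.
Proof.
move=> fM; apply/bounded_familyP; exists (sqrtC M) => A.
have M0 : 0 <= M := le_trans (sqsum_ge0 A f) (fM A).
by apply: l2_norm_le; rewrite ?sqrtC_ge0// sqrtCK.
Qed.

Definition mk_l2 (f : I -> H) M
    (fM : forall A : {fset I}, \sum_(i <- A) `|f i| ^+ 2 <= M) : l2 :=
  BFam (@complex_lub R) (l2_bounded fM).

Lemma l2_is_sum_sqr f : is_sum (fun i => `|f i| ^+ 2) (`|f| ^+ 2).
Proof.
have f0 i : 0 <= `|f i| ^+ 2 by rewrite exprn_ge0.
have [l fl lub] := nonneg_is_sum f0 (l2_partial f).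
have l0 : 0 <= l := is_sum_ge0 f0 fl.
suff -> : `|f| ^+ 2 = l by [].
apply/eqP; rewrite eq_le; apply/andP; split; last first.
  by apply: (is_sum_le f0 fl); exact: l2_partial.
rewrite -[l]sqrtCK lerXn2r ?nnegrE ?sqrtC_ge0//.
apply: l2_le => [|A]; rewrite ?sqrtC_ge0// sqrtCK.
exact: (fsum_le_is_sum f0 A fl).
Qed.

Definition l2_inner f g : C := summability.sum (fun i => <|f i, g i|> : C).

Lemma l2_is_sum_inner f g : is_sum (fun i => <|f i, g i|> : C) (l2_inner f g).
Proof.
have [|l fgl _] := @abs_is_sum R I (cline R) (fun i => <|f i, g i|>) (`|f| * `|g|).
  move=> A; apply: (@le_trans _ _ (\sum_(i <- A) `|f i| * `|g i|)).
    by apply: ler_sum => i _; exact: cauchy_schwarz.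
  by apply: finite_cauchy_schwarz => //; exact: l2_partial.
by rewrite /l2_inner (sum_is_sum fgl).
Qed.

Lemma l2_inner_eq f g l : is_sum (fun i => <|f i, g i|> : C) l -> l2_inner f g = l.
Proof. exact: (is_sum_unique (l2_is_sum_inner f g)). Qed.

Lemma scale_bounded (a : C) : bounded_operator (fun x : C => a * x).
Proof.
split=> [b x y|]; first by rewrite mulrDr mulrCA.
by exists `|a| => x; rewrite normrM.
Qed.

Lemma l2_innerPl a f g h : l2_inner (a *: f + g) h = a * l2_inner f h + l2_inner g h.
Proof.
apply: l2_inner_eq.
apply: eq_is_sum (is_sumD (is_sum_map (scale_bounded a) (l2_is_sum_inner f h))
  (l2_is_sum_inner g h)) => i.
by rewrite innerDl innerZl.
Qed.

Lemma is_sum_conj (J : choiceType) (x : J -> C) l :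
  is_sum x l -> is_sum (fun i => Num.conj (x i)) (Num.conj l).
Proof.
move=> xl e e0; have [A AP] := xl e e0; exists A => B AB.
by rewrite -rmorph_sum -rmorphB norm_conjC AP.
Qed.

Lemma l2_innerC f g : l2_inner f g = (-1) ^+ false * Num.conj (l2_inner g f).
Proof.
rewrite expr0 mul1r; apply: l2_inner_eq.
by apply: eq_is_sum (is_sum_conj (l2_is_sum_inner g f)) => i; rewrite -innerC.
Qed.

Lemma l2_inner_linl : forall h, GRing.linear_for *%R (l2_inner ^~ h).
Proof. by move=> h a f g; exact: l2_innerPl. Qed.

Lemma l2_inner_linr : forall h, GRing.linear_for (Num.conj \; *%R) (l2_inner h).
Proof.
move=> h a f g; rewrite !(l2_innerC h) !expr0 !mul1r l2_innerPl.
by rewrite rmorphD rmorphM.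
Qed.

HB.instance Definition _ := bilinear_isBilinear.Build C l2 l2 C *%R
  (Num.conj \; *%R) l2_inner (conj l2_inner_linl l2_inner_linr).
HB.instance Definition _ := isHermitianSesquilinear.Build C l2 false Num.conj
  l2_inner l2_innerC.

Lemma l2_normsqE f : `|f| ^+ 2 = l2_inner f f.
Proof.
symmetry; apply: l2_inner_eq.
by apply: eq_is_sum (l2_is_sum_sqr f) => i; rewrite normsqE.
Qed.

Lemma l2_inner_gt0 f : f != 0 -> 0 < l2_inner f f.
Proof. by move=> f0; rewrite -l2_normsqE exprn_gt0// normr_gt0. Qed.

HB.instance Definition _ := isDotProduct.Build C l2 l2_inner l2_inner_gt0.
HB.instance Definition _ := isHilbert.Build R l2 l2_normsqE.

Lemma l2_innerE f g : <|f, g|> = l2_inner f g. Proof. by []. Qed.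

Lemma single_bounded i (x : H) (A : {fset I}) :
  \sum_(j <- A) `|if j == i then x else 0| ^+ 2 <= `|x| ^+ 2.
Proof.
have z (j : I) : j != i -> `|if j == i then x else 0| ^+ 2 = 0 :> C.
  by move=> /negPf ->; rewrite normr0 expr0n.
have [iA|iA] := boolP (i \in A); last first.
  rewrite big_seq big1 ?exprn_ge0// => j jA; apply: z.
  by apply: contraNneq iA => <-.
rewrite (big_fsetD1 i)//= eqxx big_seq big1 ?addr0// => j.
by rewrite !inE => /andP[/z].
Qed.

Definition single i (x : H) : l2 := mk_l2 (single_bounded i x).

Lemma singleE i x j : single i x j = if j == i then x else 0. Proof. by []. Qed.

Lemma l2_sumE (J : Type) (r : seq J) (F : J -> l2) i :
  (\sum_(j <- r) F j : l2) i = \sum_(j <- r) F j i.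
Proof. by elim: r => [|j r IH]; rewrite ?big_nil// !big_cons bfamD IH. Qed.

Lemma inner_single f i x : <|f, single i x|> = <|f i, x|>.
Proof.
rewrite l2_innerE; apply: l2_inner_eq => e e0; exists [fset i]%fset => A.
rewrite fsub1set => iA; rewrite (big_fsetD1 i)//= eqxx big_seq big1.
  by rewrite addr0 subrr normr0 ltW.
by move=> j; rewrite !inE => /andP[/negPf -> _]; rewrite inner0r.
Qed.

(** The distance of f to a partial sum is the norm of its coordinates outside of
    the finite set. *)
Lemma l2_expand f : is_sum (fun i => single i (f i)) f.
Proof.
move=> e e0; have f0 i : 0 <= `|f i| ^+ 2 by rewrite exprn_ge0.
have [A AP] := nonneg_tail f0 (l2_partial f) (exprn_gt0 2 e0).
exists A => B AB; apply: l2_le => [|D]; first exact: ltW.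
have fE i : (f - \sum_(j <- B) single j (f j)) i = if i \in B then 0 else f i.
  rewrite bfamB l2_sumE; case: ifPn => iB.
    rewrite (big_fsetD1 i)//= eqxx big_seq big1 ?addr0 ?subrr// => j.
    by rewrite !inE eq_sym => /andP[/negPf ->].
  rewrite big_seq big1 ?subr0// => j jB; rewrite singleE ifN//.
  by apply: contraNneq iB => ->.
rewrite (fsum_split _ (fsubsetIl D B)) big_seq big1 ?add0r.
  rewrite big_seq; under eq_bigr => i.
    rewrite !inE => /andP[iDB iD]; rewrite fE ifN; last first.
      by apply: contra iDB => ->; rewrite iD.
    over.
  rewrite -big_seq; apply: AP; apply/fdisjointP => i iA.
  by rewrite !inE (fsubsetP AB i iA) andbT andNb.
by move=> i; rewrite inE fE => /andP[_ ->]; rewrite normr0 expr0n.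
Qed.

(** Families with one nonzero coordinate span a dense subspace. *)
Lemma l2_bounded_ext (W : normedModType C) (S T : l2 -> W) :
  bounded_operator S -> bounded_operator T ->
  (forall i x, S (single i x) = T (single i x)) -> S = T.
Proof.
move=> Sb Tb ST; apply/funext => f.
apply: (is_sum_unique (is_sum_map Sb (l2_expand f))).
by apply: eq_is_sum (is_sum_map Tb (l2_expand f)) => i; rewrite ST.
Qed.
End L2.
Arguments l2 {R} I H.

(** * Tensor product with square-summable scalars *)

Definition cline1 {R : realType} : cline R := (1 : Cplx R).

Section Tensor.
Context {R : realType}.
Local Notation C := (Cplx R).
Context {J : choiceType} {H : hilbertType R}.
Local Notation Ht := (l2 J (cline R)).
Local Notation HHt := (l2 J H).

Lemma l2_tens_bounded (x : H) (y : Ht) (A : {fset J}) :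
  \sum_(i <- A) `|(y i : C) *: x| ^+ 2 <= (`|y| * `|x|) ^+ 2.
Proof.
under eq_bigr do rewrite normrZ exprMn.
rewrite -mulr_suml exprMn ler_wpM2r ?exprn_ge0//.
exact: (l2_partial y A).
Qed.

(** In l2(J; H), regarded as the tensor product of H and l2(J), the vector
    x (x) y has coordinates y_i x. *)
Definition l2_tens (x : H) (y : Ht) : HHt := mk_l2 (l2_tens_bounded x y).

Lemma l2_tensE x y i : l2_tens x y i = (y i : C) *: x. Proof. by []. Qed.

Lemma l2_tens_linl (y : Ht) : linear (l2_tens ^~ y).
Proof.
move=> a u v; apply: l2_ext => i.
by rewrite bfamD bfamZ !l2_tensE scalerDr !scalerA mulrC.
Qed.

Lemma l2_tens_linr x : linear (l2_tens x).
Proof.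
move=> a u v; apply: l2_ext => i.
by rewrite bfamD bfamZ !l2_tensE bfamD bfamZ scalerDl scalerA.
Qed.

HB.instance Definition _ := bilinear_isBilinear.Build C H Ht HHt *:%R *:%R
  l2_tens (conj l2_tens_linl l2_tens_linr).

Lemma inner_l2_tens x x' y y' :
  <|l2_tens x y, l2_tens x' y'|> = <|x, x'|> * <|y, y'|>.
Proof.
apply: l2_inner_eq.
apply: eq_is_sum (is_sum_map (scale_bounded <|x, x'|>) (l2_is_sum_inner y y')) => i.
by rewrite innerZl innerZr mulrA mulrC.
Qed.

Lemma single_tens i x : single i x = l2_tens x (single i cline1) :> HHt.
Proof.
apply: l2_ext => j; rewrite l2_tensE !singleE.
by case: eqP => _; rewrite ?scale1r ?scale0r.
Qed.

Lemma l2_tens_dense (z : HHt) (eps : C) : 0 < eps ->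
  exists n (x : 'I_n -> H) (y : 'I_n -> Ht),
    `|z - \sum_(i < n) l2_tens (x i) (y i)| < eps.
Proof.
move=> e0; have [|A AP] := l2_expand z (e := eps / 2); first by rewrite divr_gt0.
pose s := in_tuple (enum_fset A).
exists (size (enum_fset A)), (fun k => z (tnth s k)), (fun k => single (tnth s k) cline1).
have -> : \sum_(k < size (enum_fset A)) l2_tens (z (tnth s k)) (single (tnth s k) cline1) =
    \sum_(i <- A) single i (z i).
  by rewrite [RHS]big_tnth; apply: eq_bigr => k _; rewrite single_tens.
apply: (le_lt_trans (AP A (fsubset_refl _))).
by rewrite ltr_pdivrMr// ltr_pMr// ltr1n.
Qed.

Definition l2_tensor : hilbert_tensor H Ht :=
  HilbertTensor inner_l2_tens l2_tens_dense.

Lemma op_tens_eq (S : H -> H) (T : Ht -> Ht) (Q : l2_tensor -> l2_tensor) :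
  bounded_operator Q -> (forall x y, Q (l2_tens x y) = l2_tens (S x) (T y)) ->
  op_tens l2_tensor S T = Q.
Proof.
move=> Qb QE; rewrite /op_tens; set D := [set Q' | _].
have DQ : D Q by [].
have [Q'b Q'E] : D (xget (fun=> 0) D) := xgetI (fun=> 0) DQ.
apply: (@l2_bounded_ext R J H l2_tensor) => // i x.
by rewrite single_tens QE -Q'E.
Qed.

Section Lift.
Variables (T : H -> H) (Tb : bounded_operator T).

Lemma l2_map_subproof (f : HHt) : exists M, forall A : {fset J},
  \sum_(i <- A) `|T (f i)| ^+ 2 <= M.
Proof.
have [M M0 TM] := bounded_cst_ge0 Tb; exists (M ^+ 2 * `|f| ^+ 2) => A.
apply: (@le_trans _ _ (\sum_(i <- A) M ^+ 2 * `|f i| ^+ 2)).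
  by apply: ler_sum => i _; rewrite -exprMn lerXn2r ?nnegrE ?mulr_ge0.
by rewrite -mulr_sumr ler_wpM2l ?exprn_ge0//; exact: l2_partial.
Qed.

(** The operator T (x) 1. *)
Definition l2_map (f : HHt) : HHt := mk_l2 (projT2 (cid (l2_map_subproof f))).

Lemma l2_mapE f i : l2_map f i = T (f i). Proof. by []. Qed.

Lemma l2_map_linear : linear l2_map.
Proof.
move=> a f g; apply: l2_ext => i.
by rewrite bfamD bfamZ !l2_mapE bfamD bfamZ Tb.1.
Qed.

Lemma l2_map_le M : 0 <= M -> (forall x, `|T x| <= M * `|x|) ->
  forall f, `|l2_map f| <= M * `|f|.
Proof.
move=> M0 TM f; apply: l2_le => [|A]; first exact: mulr_ge0.
apply: (@le_trans _ _ (\sum_(i <- A) M ^+ 2 * `|f i| ^+ 2)).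
  by apply: ler_sum => i _; rewrite -exprMn lerXn2r ?nnegrE ?mulr_ge0 ?l2_mapE.
by rewrite exprMn -mulr_sumr ler_wpM2l ?exprn_ge0//; exact: l2_partial.
Qed.

Lemma op_tens_id : op_tens l2_tensor T id = l2_map.
Proof.
apply: op_tens_eq => [|x y].
  split; first exact: l2_map_linear.
  have [M M0 TM] := bounded_cst_ge0 Tb; exists M; exact: l2_map_le.
by apply: l2_ext => i; rewrite l2_mapE !l2_tensE (linZ Tb.1).
Qed.
End Lift.

Section PureState.
Variables (i0 : J).
Let eta : Ht := single i0 cline1.

Lemma norm_single (K : hilbertType R) i (x : K) : `|single i x : l2 J K| = `|x|.
Proof. by apply: norm_inner; rewrite inner_single singleE eqxx. Qed.

(** On the simple tensor x (x) y both sides give <y, eta> (s x (x) eta), since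
    the coordinate y_{i0} is <y, eta>. *)
Lemma op_tens_state (s : H -> H) : bounded_operator s ->
  op_tens l2_tensor s (fun y => <|y, eta|> *: eta) = fun z => single i0 (s (z i0)).
Proof.
move=> sb; apply: op_tens_eq => [|x y].
  split=> [a f g|].
    apply: l2_ext => j; rewrite !bfamD !bfamZ !singleE sb.1.
    by case: eqP => // _; rewrite scaler0 addr0.
  have [M M0 sM] := bounded_cst_ge0 sb; exists M => f.
  rewrite norm_single (le_trans (sM _))// ler_wpM2l//.
  exact: (coord_le_norm (p := l2_seminorms) f i0).
apply: l2_ext => j; rewrite !l2_tensE singleE bfamZ singleE inner_single.
case: eqP => _; last by rewrite [X in X *: _]mulr0 scale0r.
rewrite (linZ sb.1); congr (_ *: _).
by rewrite [RHS]mulr1 -[RHS]/((y i0 : C) * Num.conj 1) rmorph1 mulr1.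
Qed.
End PureState.
End Tensor.

(** * Unitary extension of isometries with orthogonal ranges *)

Lemma big_fset_imfset_inj (V : zmodType) (I J : choiceType) (k : I -> J)
    (A : {fset I}) (f : J -> V) :
  {in A &, injective k} ->
  \sum_(j <- [fset k i | i in A]%fset) f j = \sum_(i <- A) f (k i).
Proof. by move=> kinj; rewrite big_imfset. Qed.

Section Reindex.
Context {R : realType}.
Local Notation C := (Cplx R).
Context {I J : choiceType} (k : I -> J) (kinj : injective k).

Lemma reindex_partial (f : J -> C) M :
  (forall B : {fset J}, \sum_(j <- B) f j <= M) ->
  forall A : {fset I}, \sum_(i <- A) f (k i) <= M.
Proof.
move=> fM A; rewrite -big_fset_imfset_inj ?fM// => i j _ _; exact: kinj.
Qed.

Lemma reindex_is_sum (V : normedModType C) (f : J -> V) l :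
  (forall j, (forall i, j <> k i) -> f j = 0) -> is_sum f l ->
  is_sum (fun i => f (k i)) l.
Proof.
move=> f0 fl e e0; have [A AP] := fl e e0.
have [B BP] : exists B : {fset I}, forall i, k i \in A -> i \in B.
  have [g gP] : exists g : J -> option I, forall i, g (k i) = Some i.
    have /choice[g gP] : forall j, exists o : option I, forall i, k i = j -> o = Some i.
      move=> j; have [[i ij]|nj] := pselect (exists i, k i = j).
        by exists (Some i) => i'; rewrite -ij => /kinj ->.
      by exists None => i ij; case: nj; exists i.
    by exists g => i; exact: gP.
  exists [fset i | i in pmap g (enum_fset A)]%fset => i kA.
  by rewrite !inE /= mem_pmap -(gP i); apply: map_f.
exists B => D BD; rewrite -big_fset_imfset_inj; last by move=> i j _ _; exact: kinj.
set kD := [fset k i | i in D]%fset.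
have -> : \sum_(j <- kD) f j = \sum_(j <- (A `|` kD)%fset) f j.
  apply: big_fset_incl; first exact: fsubsetUr.
  move=> j; rewrite in_fsetU => /orP[jA|->//] jD; apply: f0 => i ji.
  move/negP: jD; apply; rewrite ji in_imfset//=.
  by apply: (fsubsetP BD); apply: BP; rewrite -ji.
exact: AP (fsubsetUl _ _).
Qed.
End Reindex.

Section Isometries.
Context {R : realType}.
Local Notation C := (Cplx R).

Lemma isometry_inner (H1 H2 : hilbertType R) (T : H1 -> H2) :
  linear T -> (forall x, `|T x| = `|x|) -> forall x y, <|T x, T y|> = <|x, y|>.
Proof.
move=> Tl Tn x y; apply/eqP; rewrite -subr_eq0; apply/eqP.
apply: (@sesqui_eq0 _ _ (fun x y => <|T x, T y|> - <|x, y|>)) => [a u v w|a u v w|u].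
- by rewrite Tl !innerDl !innerZl mulrBr opprD addrACA.
- by rewrite Tl !innerDr !innerZr mulrBr opprD addrACA.
- by rewrite -!normsqE Tn subrr.
Qed.

Lemma isometry_bounded (V W : normedModType C) (T : V -> W) :
  linear T -> (forall x, `|T x| = `|x|) -> bounded_operator T.
Proof. by move=> Tl Tn; split=> //; exists 1 => x; rewrite Tn mul1r. Qed.

(** Expand |T^* T x - x|^2 = |T^* T x|^2 - 2 |T x|^2 + |x|^2 <= 0. *)
Lemma contraction_adjointK (H1 H2 : hilbertType R) (T : H1 -> H2) x :
  bounded_operator T -> (forall y, `|T y| <= `|y|) -> `|T x| = `|x| ->
  adjoint T (T x) = x.
Proof.
move=> Tb Tc Tx; apply/eqP; rewrite -subr_eq0; apply/eqP/inner_eq0.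
have T'c y : `|adjoint T y| <= `|y|.
  by rewrite -[leRHS]mul1r; apply: (adjoint_le Tb) => // z; rewrite mul1r.
apply/eqP; rewrite eq_le -normsqE exprn_ge0// andbT normsqE.
have xT : <|x, adjoint T (T x)|> = `|x| ^+ 2 by rewrite -adjointP// -normsqE Tx.
have Tx' : <|adjoint T (T x), x|> = `|x| ^+ 2.
  by rewrite innerC xT; apply/CrealP/ger0_real/exprn_ge0.
rewrite innerBl !innerBr xT Tx' -normsqE -[<|x, x|>]normsqE subrr subr0.
rewrite subr_le0 lerXn2r ?nnegrE//.
by rewrite (le_trans (T'c _))// Tx.
Qed.
End Isometries.

Section Shift.
Context {R : realType} {G : zmodType} {H : hilbertType R}.
Local Notation L := (l2 G H).

Lemma shift_bounded g (f : L) (A : {fset G}) :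
  \sum_(h <- A) `|f (h - g)| ^+ 2 <= `|f| ^+ 2.
Proof.
apply: (reindex_partial (k := fun h => h - g) _ (f := fun h => `|f h| ^+ 2)).
  exact: addIr.
exact: l2_partial.
Qed.

Definition shift g (f : L) : L := mk_l2 (shift_bounded g f).

Lemma shiftE g f h : shift g f h = f (h - g). Proof. by []. Qed.

Lemma shift0 f : shift 0 f = f.
Proof. by apply: l2_ext => h; rewrite shiftE subr0. Qed.

Lemma shiftD g g' f : shift (g + g') f = shift g (shift g' f).
Proof. by apply: l2_ext => h; rewrite !shiftE opprD addrA. Qed.

Lemma shift_linear g : linear (shift g).
Proof. by move=> a f f'; apply: l2_ext. Qed.

Lemma norm_shift g f : `|shift g f| = `|f|.
Proof.
have le g' f' : `|shift g' f'| <= `|f'|.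
  by apply: l2_le => [|A]; [exact: normr_ge0|exact: shift_bounded].
apply/eqP; rewrite eq_le le /=.
by have := le (- g) (shift g f); rewrite -shiftD addNr shift0.
Qed.

Lemma inner_shift g f f' : <|shift g f, f'|> = <|f, shift (- g) f'|>.
Proof.
rewrite -(isometry_inner (shift_linear (- g)) (norm_shift (- g))).
by rewrite -shiftD addNr shift0.
Qed.

Lemma shift_single g h (x : H) : shift g (single h x) = single (h + g) x.
Proof. by apply: l2_ext => i; rewrite shiftE !singleE subr_eq. Qed.
End Shift.

(** The map x |-> (A_s x)_s is an isometry into l2(S; H). *)
Definition isometric_family {R : realType} {S : choiceType} {H : hilbertType R}
    (A : S -> H -> H) :=
  (forall s, linear (A s)) /\ forall x, is_sum (fun s => `|A s x| ^+ 2) (`|x| ^+ 2).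

Section DilationUnitaries.
Context {R : realType} {G : zmodType} {S : choiceType} {H : hilbertType R}.
Local Notation C := (Cplx R).
Variables (A : G -> S -> H -> H) (A_iso : forall g, isometric_family (A g)).
Local Notation J := (G * S)%type.
Local Notation L := (l2 G H).
Local Notation K := (l2 J H).

(** Group the pairs (h, s) by h; the terms above h sum up to at most |f h|^2. *)
Lemma family_bounded (f : L) (F : {fset J}) :
  \sum_(j <- F) `|A j.1 j.2 (f j.1)| ^+ 2 <= `|f| ^+ 2.
Proof.
rewrite (partition_big_imfset _ (fun j : J => j.1)) /=.
apply: le_trans (l2_partial f [fset j.1 | j in F]%fset); apply: ler_sum => h _.
rewrite big_fset_condE /=.
set Fh := [fset _ | _ in _]%fset.
have -> : \sum_(j <- Fh) `|A j.1 j.2 (f j.1)| ^+ 2 =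
    \sum_(s <- [fset j.2 | j in Fh]%fset) `|A h s (f h)| ^+ 2.
  rewrite (big_fset_imfset_inj (k := fun j : J => j.2)).
    rewrite !big_seq; apply: eq_bigr => j.
    by rewrite !inE /= => /andP[_ /eqP ->].
  move=> [h1 s1] [h2 s2]; rewrite !inE /= => /andP[_ /eqP ->] /andP[_ /eqP ->].
  by move=> ->.
apply: (fsum_le_is_sum _ _ ((A_iso h).2 (f h))) => s.
exact: exprn_ge0.
Qed.

(** The isometry D from l2(G; H), whose restriction to the coordinate g is the
    isometry of the family A_g, placed in its own copy of S. *)
Definition dil (f : L) : K := mk_l2 (family_bounded f).

Lemma dilE f j : dil f j = A j.1 j.2 (f j.1). Proof. by []. Qed.

Lemma dil_linear : linear dil.
Proof.
move=> a f f'; apply: l2_ext => j.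
by rewrite bfamD bfamZ !dilE bfamD bfamZ (A_iso _).1.
Qed.

Lemma dil_le f : `|dil f| <= `|f|.
Proof. by apply: l2_le => // F; exact: family_bounded. Qed.

Lemma dil_bounded : bounded_operator dil.
Proof. by split; [exact: dil_linear|exists 1 => f; rewrite mul1r dil_le]. Qed.

Lemma norm_dil_single h x : `|dil (single h x)| = `|x|.
Proof.
apply/eqP; rewrite eq_le; apply/andP; split.
  by rewrite (le_trans (dil_le _))// norm_single.
rewrite -(@ler_pXn2r _ 2) ?nnegrE//.
apply: (is_sum_le _ ((A_iso h).2 x)) => [s|B]; first exact: exprn_ge0.
have := reindex_partial (k := fun s => (h, s)) _ (l2_partial (dil (single h x))).
move=> /(_ _ B) h1; apply: le_trans (h1 _) => [|s s' []//].
by rewrite le_eqVlt; apply/orP; left; apply/eqP/eq_bigr => s _; rewrite dilE singleE eqxx.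
Qed.

(** A contraction that preserves the norm of x satisfies T^* T x = x; vectors
    with a single coordinate suffice, and on these D is one of the isometries
    of the families. *)
Lemma dilK f : adjoint dil (dil f) = f.
Proof.
have Db := dil_bounded.
suff : adjoint dil \o dil = id by move=> /(congr1 (fun F => F f)).
apply: l2_bounded_ext => [||h x].
- split=> [a u v|]; first by rewrite /= dil_linear (adjoint_linear Db).
  exists 1 => u; rewrite /= (le_trans (adjoint_le Db ler01 _ _))//.
    by move=> v; rewrite mul1r dil_le.
  by rewrite !mul1r dil_le.
- by split=> //; exists 1 => u; rewrite mul1r.
- by apply: contraction_adjointK => //=; [exact: dil_le|rewrite norm_dil_single norm_single].
Qed.

(** The shift on the range of D, and the identity on its orthogonal complement. *)
Definition dil_unitary g (z : K) : K :=
  z - dil (adjoint dil z) + dil (shift g (adjoint dil z)).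
Local Notation U := dil_unitary.

Lemma dil_unitary0 z : U 0 z = z.
Proof. by rewrite /U shift0 subrK. Qed.

Lemma adjoint_dil_unitary g z : adjoint dil (U g z) = shift g (adjoint dil z).
Proof.
have al := adjoint_linear dil_bounded.
by rewrite /U (linD al) (linB al) !dilK subrr add0r.
Qed.

Lemma dil_unitaryD g g' z : U (g + g') z = U g (U g' z).
Proof.
rewrite [U g _]/dil_unitary adjoint_dil_unitary -shiftD /U; congr (_ + _).
by rewrite addrK.
Qed.

Lemma dil_unitary_linear g : linear (U g).
Proof.
move=> a u v; rewrite /U (adjoint_linear dil_bounded) shift_linear !dil_linear.
by rewrite scalerDr scalerBr opprD [a *: u + v + _]addrACA [LHS]addrACA.
Qed.

Lemma inner_dil_unitary g z z' : <|U g z, z'|> = <|z, U (- g) z'|>.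
Proof.
have Db := dil_bounded.
rewrite /U !innerDl innerNl !innerDr innerNr !(adjointP Db) inner_shift.
by rewrite !(adjointPr Db).
Qed.

Lemma norm_dil_unitary g z : `|U g z| = `|z|.
Proof. by apply: norm_inner; rewrite inner_dil_unitary -dil_unitaryD addNr dil_unitary0. Qed.

Lemma dil_unitary_bounded g : bounded_operator (U g).
Proof. exact: isometry_bounded (dil_unitary_linear g) (norm_dil_unitary g). Qed.

Lemma adjoint_dil_unitaryE g : adjoint (U g) = U (- g).
Proof. exact: (adjoint_eq (dil_unitary_bounded g) (inner_dil_unitary g)). Qed.

Lemma dil_unitaryP g : unitary (U g).
Proof.
split; first exact: dil_unitary_bounded.
  by apply/funext => z; rewrite adjoint_dil_unitaryE /= -dil_unitaryD addNr dil_unitary0.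
by apply/funext => z; rewrite adjoint_dil_unitaryE /= -dil_unitaryD subrr dil_unitary0.
Qed.

Lemma dil_unitary_dil g h x : U g (dil (single h x)) = dil (single (h + g) x).
Proof. by rewrite /U dilK subrr add0r shift_single. Qed.
End DilationUnitaries.

(** * The trace identity of a Kraus family *)

Section BoundedAlgebra.
Context {K : numFieldType} {V W : normedModType K}.

Lemma bounded_operatorD (S T : V -> W) : bounded_operator S -> bounded_operator T ->
  bounded_operator (fun x => S x + T x).
Proof.
move=> [Sl [M SM]] [Tl [N TN]]; split=> [a x y|].
  by rewrite Sl Tl scalerDr addrACA.
exists (M + N) => x; rewrite mulrDl.
by rewrite (le_trans (ler_normD _ _))// lerD.
Qed.

Lemma bounded_operatorN (S : V -> W) :
  bounded_operator S -> bounded_operator (fun x => - S x).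
Proof.
move=> [Sl [M SM]]; split=> [a x y|]; first by rewrite Sl opprD scalerN.
by exists M => x; rewrite normrN.
Qed.

Lemma bounded_operator_sum (J : Type) (r : seq J) (S : J -> V -> W) :
  (forall j, bounded_operator (S j)) ->
  bounded_operator (fun x => \sum_(j <- r) S j x).
Proof.
move=> Sb; elim: r => [|j r IH].
  split=> [a x y|]; first by rewrite !big_nil scaler0 addr0.
  by exists 0 => x; rewrite big_nil normr0 mul0r.
rewrite (_ : (fun x => _) = fun x => S j x + \sum_(i <- r) S i x).
  exact: bounded_operatorD.
by apply/funext => x; rewrite big_cons.
Qed.
End BoundedAlgebra.

Section TraceAlgebra.
Context {R : realType} {H : hilbertType R}.
Local Notation C := (Cplx R).

Lemma has_traceZ (a : C) (T : H -> H) l :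
  has_trace T l -> has_trace (fun x => a *: T x) (a * l).
Proof.
move=> Tl; apply: eq_is_sum (is_sum_map (scale_bounded a) Tl) => e.
by rewrite /diag; case: ifP => _; rewrite ?innerZl ?mulr0.
Qed.

Lemma has_traceB (S T : H -> H) l m :
  has_trace S l -> has_trace T m -> has_trace (fun x => S x - T x) (l - m).
Proof.
move=> Sl /(has_traceZ (-1)) Tm; rewrite mulN1r in Tm.
by apply: eq_is_sum (has_traceD Sl Tm) => e; rewrite /diag scaleN1r.
Qed.

Lemma has_trace_sum (J : Type) (r : seq J) (S : J -> H -> H) (l : J -> C) :
  (forall j, has_trace (S j) (l j)) ->
  has_trace (fun x => \sum_(j <- r) S j x) (\sum_(j <- r) l j).
Proof.
move=> Sl; elim: r => [|j r IH].
  rewrite big_nil; apply: eq_is_sum (is_sum_0 _) => e.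
  by rewrite /diag big_nil inner0l; case: ifP.
rewrite big_cons; apply: eq_is_sum (has_traceD (Sl j) IH) => e.
by rewrite /diag big_cons.
Qed.

Lemma trace_class_has_trace (T : H -> H) : trace_class T -> has_trace T (trace T).
Proof.
move=> Ttc; have [l ll _] := @trace_class_bound R H H T 1 id id id Ttc
  (fun _ _ _ => erefl) ler01 (@id_bound R H) (fun _ _ => erefl) (fun _ => lexx _).
by rewrite (has_traceE (ll : has_trace T l)).
Qed.
End TraceAlgebra.

Section KrausTrace.
Context {R : realType} {H : hilbertType R} {S : choiceType}.
Local Notation C := (Cplx R).
Local Notation rank1 p w := (fun z : H => <|z, p|> *: w).

(** The operators A_s satisfy Phi(|x><x|) = sum_s |A_s x><A_s x| in the weak
    sense.  The diagonal case x = y is enough, by polarization. *)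
Definition kraus_family (Phi : (H -> H) -> H -> H) (A : S -> H -> H) :=
  isometric_family A /\ forall x a b,
    is_sum (fun s => <|A s x, b|> * <|a, A s x|> : C) <|Phi (rank1 x x) a, b|>.

Variables (Phi : (H -> H) -> H -> H) (A : S -> H -> H).
Hypothesis Phi_lin : trace_class_linear Phi.
Hypothesis Phi_contr : trace_norm_contraction Phi.
Hypothesis Phi_tp : trace_preserving Phi.
Hypothesis PhiA : kraus_family Phi A.

(** The operators Y F = Phi(|x><x|) - sum_F |A_s x><A_s x| are positive, with
    traces |x|^2 - sum_F |A_s x|^2 that tend to 0.  Hence so do the traces of
    T (Y F), by [trace_bound]. *)
Lemma kraus_trace_diag (T : H -> H) x : bounded_operator T ->
  is_sum (fun s => <|T (A s x), A s x|> : C) (trace (T \o Phi (rank1 x x))).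
Proof.
move=> Tb; have [M M0 TM] := bounded_cst_ge0 Tb; have [[Al An] weak] := PhiA.
set X := Phi (rank1 x x).
have Xtc : trace_class X := Phi_lin.1 _ (rank1_trace_class x x).
have sq0 s : 0 <= `|A s x| ^+ 2 by exact: exprn_ge0.
pose XF (F : {fset S}) z := \sum_(s <- F) <|z, A s x|> *: A s x.
pose Y F z := X z - XF F z.
have XFb F : bounded_operator (XF F).
  apply: bounded_operator_sum => s; exact: (rank1_pos _).1.
have Ypos F : positive_op (Y F).
  split; first exact: bounded_operatorD Xtc.1 (bounded_operatorN (XFb F)).
  move=> a; rewrite innerBl subr_ge0 inner_suml.
  have f0 s : 0 <= <|A s x, a|> * <|a, A s x|>.
    by rewrite [<|A s x, a|>]innerC -normCKC exprn_ge0.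
  have := fsum_le_is_sum f0 F (weak x a a); apply: le_trans.
  by apply: ler_sum => s _; rewrite innerZl mulrC.
have trX : has_trace X (`|x| ^+ 2).
  have := trace_class_has_trace Xtc; rewrite Phi_tp; last exact: rank1_trace_class.
  by rewrite (has_traceE (has_trace_rank1 x x)) -normsqE.
have trY F : has_trace (Y F) (`|x| ^+ 2 - \sum_(s <- F) `|A s x| ^+ 2).
  apply: has_traceB trX _.
  have := has_trace_sum F (fun s => has_trace_rank1 (A s x) (A s x)).
  by under [X in has_trace _ X]eq_bigr do rewrite -normsqE.
have YY F : same_norm (Y F) (Y F) by split=> //; exact: pos_linear (Ypos F).
have trTY F : exists2 m, has_trace (T \o Y F) m &
    `|m| <= M * (`|x| ^+ 2 - \sum_(s <- F) `|A s x| ^+ 2).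
  apply: (@trace_bound R H H H _ (Y F) _ M T id id (YY F) _ Tb.1 M0 TM
    (fun _ _ => erefl) (fun _ => lexx _)) => B.
  by apply: (fsum_le_is_sum _ _ (trY F)) => e; exact: diag_ge0.
have trTXF F : has_trace (T \o XF F) (\sum_(s <- F) <|T (A s x), A s x|>).
  have := has_trace_sum F (fun s => has_trace_rank1 (A s x) (T (A s x))).
  apply: eq_is_sum => e; rewrite /diag /= (lin_sum Tb.1).
  by under [in RHS]eq_bigr do rewrite (linZ Tb.1).
move=> e e0; have M1 : 0 < M + 1 by rewrite ltr_wpDl.
have [F0 F0P] := An x _ (divr_gt0 e0 M1); exists F0 => F1 F0F.
have [m trm mM] := trTY F1.
have -> : trace (T \o X) = \sum_(s <- F1) <|T (A s x), A s x|> + m.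
  apply: has_traceE; apply: eq_is_sum (has_traceD (trTXF F1) trm) => f.
  by rewrite /diag /= -(linD Tb.1) /Y addrC subrK.
rewrite addrAC subrr add0r.
apply: (le_trans mM); have := F0P F1 F0F.
rewrite ger0_norm ?subr_ge0; last exact: (fsum_le_is_sum sq0 F1 (An x)).
move=> h; apply: (le_trans (ler_wpM2l M0 h)).
by rewrite mulrCA ler_piMr ?(ltW e0)// ler_pdivrMr// mul1r lerDl.
Qed.

Section Dilation.
Context {K : hilbertType R}.
Variables (V : H -> K) (V' : K -> H) (T : H -> H) (W : K -> K).
Hypothesis Tb : bounded_operator T.
Hypothesis Wb : bounded_operator W.
Hypothesis Vl : linear V.
Hypothesis Vn : forall x, `|V x| = `|x|.
Hypothesis VV' : forall z x, <|V' z, x|> = <|z, V x|>.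
Hypothesis WV : forall x, is_sum (fun s => <|T (A s x), A s x|> : C) <|W (V x), V x|>.

Let tr1 (s : H -> H) : C := trace (T \o Phi s).
Let tr2 (s : H -> H) : C := trace (W \o V \o s \o V').

Let tr1P s : trace_class s -> has_trace (T \o Phi s) (tr1 s).
Proof.
move=> stc; have [M M0 TM] := bounded_cst_ge0 Tb.
have [l ll _] := @trace_class_bound R H H (Phi s) M T id id (Phi_lin.1 _ stc) Tb.1 M0
  TM (fun _ _ => erefl) (fun _ => lexx _).
by rewrite /tr1 (has_traceE (ll : has_trace (T \o Phi s) l)).
Qed.

Let tr1D a s t : trace_class s -> trace_class t ->
  tr1 (fun x => a *: s x + t x) = a * tr1 s + tr1 t.
Proof.
move=> stc ttc; apply: has_traceE; rewrite Phi_lin.2//.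
apply: eq_is_sum (has_traceD (has_traceZ a (tr1P stc)) (tr1P ttc)) => e.
by rewrite /diag /= (linD Tb.1) (linZ Tb.1).
Qed.

Let WVl : linear (W \o V). Proof. by move=> a u v; rewrite /= Vl Wb.1. Qed.

Let tr2_bound s M : trace_class s -> 0 <= M -> (forall z, `|W z| <= M * `|z|) ->
  exists2 l, has_trace (W \o V \o s \o V') l & `|l| <= M * trace_norm s.
Proof.
move=> stc M0 WM; apply: (@trace_class_bound R H K s M (W \o V) V' V) => //.
- by move=> x; rewrite -(Vn x); exact: WM.
- by move=> x; rewrite Vn.
Qed.

Let tr2P s : trace_class s -> has_trace (W \o V \o s \o V') (tr2 s).
Proof.
move=> stc; have [M M0 WM] := bounded_cst_ge0 Wb.
by have [l ll _] := tr2_bound stc M0 WM; rewrite /tr2 (has_traceE ll).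
Qed.

Let tr2D s t : trace_class s -> trace_class t ->
  tr2 (fun x => s x + t x) = tr2 s + tr2 t.
Proof.
move=> stc ttc; apply: has_traceE.
apply: eq_is_sum (has_traceD (tr2P stc) (tr2P ttc)) => e.
by rewrite /diag /= -(linD WVl).
Qed.

Let tr2_rank1 p w : tr2 (rank1 p w) = <|W (V w), V p|>.
Proof.
apply: has_traceE; apply: eq_is_sum (has_trace_rank1 (V p) (W (V w))) => e.
by rewrite /diag /= (linZ Vl) (linZ Wb.1) VV'.
Qed.

Let tr_rank1 p w : tr1 (rank1 p w) = tr2 (rank1 p w).
Proof.
apply/eqP; rewrite -subr_eq0 tr2_rank1; apply/eqP.
pose Q w p := tr1 (rank1 p w) - <|W (V w), V p|>.
have tc := @rank1_trace_class R H.
apply: (@sesqui_eq0 R H Q) => [a x y z|a x y z|x].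
- rewrite /Q (_ : rank1 z (a *: x + y) = fun v => a *: rank1 z x v + rank1 z y v).
    rewrite tr1D//; have -> : W (V (a *: x + y)) = a *: W (V x) + W (V y) by exact: WVl.
    by rewrite innerDl innerZl mulrBr opprD addrACA.
  by apply/funext => v; rewrite scalerDr !scalerA mulrC.
- rewrite /Q (_ : rank1 (a *: x + y) z =
      fun v => Num.conj a *: rank1 x z v + rank1 y z v).
    by rewrite tr1D// Vl innerDr innerZr mulrBr opprD addrACA.
  by apply/funext => v; rewrite innerDr innerZr scalerDl scalerA.
- rewrite /Q; apply/eqP; rewrite subr_eq0; apply/eqP.
  exact: is_sum_unique (kraus_trace_diag x Tb) (WV x).
Qed.

(** Here V is the isometry of the Kraus family, V' its adjoint, and W stands for
    T (x) 1: the right-hand side is the trace of W V s V^*.  Both sides are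
    bounded by multiples of the trace norm of s, so that s of rank one suffices; then both
    sides are sesquilinear in the two vectors, so that s = |x><x| suffices. *)
Lemma kraus_trace s : trace_class s -> trace (T \o Phi s) = trace (W \o V \o s \o V').
Proof.
move=> stc; apply/eqP; rewrite -subr_eq0; apply/eqP.
have [M M0 TM] := bounded_cst_ge0 Tb; have [N N0 WN] := bounded_cst_ge0 Wb.
apply: (@trace_class_density R H (fun s => tr1 s - tr2 s) (M + N)) => //.
- move=> p w t ttc _; have rtc := rank1_trace_class p w.
  rewrite tr2D// -tr_rank1.
  have -> : tr1 (fun x => <|x, p|> *: w + t x) = tr1 (rank1 p w) + tr1 t.
    rewrite -[tr1 (rank1 p w)]mul1r -tr1D//; congr tr1.
    by apply/funext => x; rewrite scale1r.
  by rewrite opprD addrACA subrr add0r.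
- exact: addr_ge0.
- move=> t ttc; rewrite mulrDl (le_trans (ler_normB _ _))// lerD//.
    have [l ll lM] := @trace_class_bound R H H (Phi t) M T id id (Phi_lin.1 _ ttc) Tb.1
      M0 TM (fun _ _ => erefl) (fun _ => lexx _).
    have -> : tr1 t = l by exact: has_traceE ll.
    by rewrite (le_trans lM)// ler_wpM2l//; exact: Phi_contr.2.
  by have [l ll lN] := tr2_bound ttc N0 WN; rewrite /tr2 (has_traceE ll).
Qed.
End Dilation.
End KrausTrace.

(** * Positive kernels *)

Section SumExchange.
Context {R : realType}.
Local Notation C := (Cplx R).

Lemma is_sum_bigsum (V : normedModType C) (I : choiceType) (J : Type) (r : seq J)
    (x : J -> I -> V) (l : J -> V) :
  (forall j, is_sum (x j) (l j)) ->
  is_sum (fun i => \sum_(j <- r) x j i) (\sum_(j <- r) l j).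
Proof.
move=> xl; elim: r => [|j r IH].
  by rewrite big_nil; apply: eq_is_sum (is_sum_0 _) => i; rewrite big_nil.
by rewrite big_cons; apply: eq_is_sum (is_sumD (xl j) IH) => i; rewrite big_cons.
Qed.

(** Both totals are the supremum of the sums over finite rectangles. *)
Lemma is_sum_exchange (I J : choiceType) (u : I -> J -> C) b c l :
  (forall i j, 0 <= u i j) -> (forall i, is_sum (u i) (b i)) ->
  (forall j, is_sum (u ^~ j) (c j)) -> is_sum c l -> is_sum b l.
Proof.
move=> u0 ub uc cl.
have b0 i : 0 <= b i by exact: (is_sum_ge0 (u0 i) (ub i)).
have c0 j : 0 <= c j by exact: (is_sum_ge0 (fun i => u0 i j) (uc j)).
have bl (F : {fset I}) : \sum_(i <- F) b i <= l.
  apply: (is_sum_le _ (is_sum_bigsum F ub)) => [j|A].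
    by apply: sumr_ge0.
  apply: le_trans (fsum_le_is_sum c0 A cl); apply: ler_sum => j _.
  exact: (fsum_le_is_sum _ F (uc j)).
have [l' bl' _] := nonneg_is_sum b0 bl.
suff -> : l = l' by [].
apply/eqP; rewrite eq_le; apply/andP; split; last exact: (is_sum_le b0 bl' bl).
apply: (is_sum_le c0 cl) => A.
apply: (is_sum_le _ (is_sum_bigsum A uc)) => [i|F]; first by apply: sumr_ge0.
apply: le_trans (fsum_le_is_sum b0 F bl'); apply: ler_sum => i _.
exact: (fsum_le_is_sum _ A (ub i)).
Qed.
End SumExchange.

Section Kernels.
Context {R : realType} {I : Type}.
Local Notation C := (Cplx R).

(** The Hermitian form of the kernel at the formal combination [xs] of points
    of I; [evalc] is the value of a function at such a combination. *)
Definition quad (k : I -> I -> C) (xs : seq (C * I)) : C :=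
  \sum_(p <- xs) \sum_(q <- xs) p.1 * Num.conj q.1 * k p.2 q.2.

Definition evalc (a : I -> C) (xs : seq (C * I)) : C := \sum_(p <- xs) p.1 * a p.2.

Definition pos_kernel (k : I -> I -> C) := forall xs, 0 <= quad k xs.

Lemma quad1 k i : quad k [:: (1, i)] = k i i.
Proof. by rewrite /quad !big_seq1 /= conjC1 !mul1r. Qed.

Lemma quad2 k i j (t : C) : quad k [:: (1, i); (t, j)] =
  k i i + Num.conj t * k i j + t * k j i + `|t| ^+ 2 * k j j.
Proof.
rewrite /quad !big_cons !big_nil /= conjC1 !mul1r !mulr1 !addr0 normCK.
by rewrite -!addrA.
Qed.

Section Theory.
Variables (k : I -> I -> C) (kpos : pos_kernel k).

Lemma pos_kernel_ge0 i : 0 <= k i i. Proof. by rewrite -quad1. Qed.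

(** Nonnegative numbers are real; the form at i + t j, for t = 1 and for t the
    imaginary unit, gives the real and the imaginary part. *)
Lemma pos_kernel_herm i j : k i j = Num.conj (k j i).
Proof.
have real t : Num.conj t * k i j + t * k j i \is Num.real.
  have -> : Num.conj t * k i j + t * k j i =
      quad k [:: (1, i); (t, j)] - k i i - `|t| ^+ 2 * k j j.
    by rewrite quad2; ring.
  have k0 := pos_kernel_ge0.
  by apply: rpredB; [apply: rpredB|]; apply: ger0_real; rewrite ?mulr_ge0 ?exprn_ge0.
have /CrealP := real 1; rewrite conjC1 !mul1r rmorphD => e1.
have e2 : Num.conj (k i j) - Num.conj (k j i) = k j i - k i j.
  apply: (mulfI (neq0Ci C)).
  have /CrealP := real 'i; rewrite conjCi rmorphD !rmorphM rmorphN /= conjCi opprK.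
  rewrite mulNr => e2.
  have -> : 'i * (k j i - k i j) = - 'i * k i j + 'i * k j i by ring.
  by rewrite -e2 mulrBr.
have /eqP : Num.conj (k i j) *+ 2 = k j i *+ 2.
  have -> : Num.conj (k i j) *+ 2 = (Num.conj (k i j) + Num.conj (k j i)) +
    (Num.conj (k i j) - Num.conj (k j i)) by ring.
  by rewrite e1 e2; ring.
by rewrite eqrMn2r /= => /eqP <-; rewrite conjCK.
Qed.

Definition quadl (xs : seq (C * I)) (j : I) : C := \sum_(p <- xs) p.1 * k p.2 j.

Lemma quad_rcons xs t j : quad k (rcons xs (t, j)) =
  quad k xs + Num.conj t * quadl xs j + t * Num.conj (quadl xs j) + `|t| ^+ 2 * k j j.
Proof.
have inner (c : C) i : \sum_(q <- rcons xs (t, j)) c * Num.conj q.1 * k i q.2 =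
    \sum_(q <- xs) c * Num.conj q.1 * k i q.2 + c * Num.conj t * k i j.
  by rewrite -cats1 big_cat big_seq1.
rewrite {1}/quad; under eq_bigr do rewrite inner.
rewrite -cats1 big_cat big_seq1 /= big_split /= -/(quad k xs) -!addrA; congr (_ + _).
rewrite normCK; congr (_ + (_ + _)).
  by rewrite mulr_sumr; apply: eq_bigr => p _; ring.
rewrite rmorph_sum mulr_sumr; apply: eq_bigr => q _.
by rewrite rmorphM /= -pos_kernel_herm; ring.
Qed.

(** Minimize the form over xs + t j.  If k j j = 0, the form is affine in t
    along the direction of - c, and would take the value -1 if c were not 0. *)
Lemma pos_kernel_cs xs j : `|quadl xs j| ^+ 2 <= quad k xs * k j j.
Proof.
set c := quadl xs j; set q := quad k xs.
have q0 : 0 <= q by exact: kpos.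
have h t : 0 <= q + Num.conj t * c + t * Num.conj c + `|t| ^+ 2 * k j j.
  by rewrite -quad_rcons.
have cc : c * Num.conj c = `|c| ^+ 2 by rewrite normCK.
have [k0|kn0] := eqVneq (k j j) 0.
  have [->|c0] := eqVneq c 0; first by rewrite normr0 expr0n mulr_ge0// k0.
  have nc : 0 < `|c| ^+ 2 by rewrite exprn_gt0// normr_gt0.
  (* At t = - r c the form is q - 2 r |c|^2, that is -1. *)
  pose r := (q + 1) / (`|c| ^+ 2 * 2).
  have rR : Num.conj r = r.
    apply/CrealP/ger0_real; rewrite divr_ge0 ?mulr_ge0 ?addr_ge0 ?exprn_ge0//.
  have := h (- (r * c)); rewrite k0 mulr0 addr0 rmorphN rmorphM /= rR.
  have -> : q + - (r * Num.conj c) * c + - (r * c) * Num.conj c = - 1.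
    have -> : q + - (r * Num.conj c) * c + - (r * c) * Num.conj c =
      q - r * (c * Num.conj c * 2) by ring.
    rewrite cc /r divfK; first by rewrite opprD addrA subrr add0r.
    by rewrite mulf_neq0 ?gt_eqF.
  by rewrite oppr_ge0 => /le_lt_trans /(_ ltr01); rewrite ltxx.
have kp : 0 < k j j by rewrite lt_def kn0 pos_kernel_ge0.
have kR : Num.conj (k j j)^-1 = (k j j)^-1.
  by apply/CrealP/ger0_real; rewrite invr_ge0 ltW.
have := h (- (c / k j j)).
have -> : `|- (c / k j j)| ^+ 2 * k j j = `|c| ^+ 2 / k j j.
  rewrite normrN normrM normfV (gtr0_norm kp) exprMn exprVn expr2 -!mulrA.
  by congr (_ * (_ * _)); rewrite expr2 invfM -mulrA mulVf ?mulr1.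
rewrite rmorphN rmorphM /= kR.
have -> : q + - (Num.conj c * (k j j)^-1) * c + - (c / k j j) * Num.conj c +
   `|c| ^+ 2 / k j j = q - `|c| ^+ 2 / k j j.
  by rewrite -cc; move: (k j j)^-1 => r; ring.
by rewrite subr_ge0 ler_pdivrMr.
Qed.
End Theory.
End Kernels.

(** * Decomposition of positive kernels into rank-one kernels *)

Section KernelDecomposition.
Context {R : realType} {I : Type}.
Local Notation C := (Cplx R).
Local Notation S := (nat * (I -> C))%type.
Variables (k : I -> I -> C) (kpos : pos_kernel k).

(** Functions are tagged with a natural number, so that a set of tagged
    functions can contain the same function several times. *)
Definition dominated_tags (B : set S) := forall F : {fset S}, (forall s, s \in F -> B s) ->
  forall xs, \sum_(s <- F) `|evalc s.2 xs| ^+ 2 <= quad k xs.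

Lemma chain_finite (FF : set (set S)) (l : seq S) :
  total_on FF subset -> (forall s, s \in l -> (\bigcup_(X in FF) X) s) ->
  l = [::] \/ exists2 X, FF X & forall s, s \in l -> X s.
Proof.
move=> tot; elim: l => [|s l IH] ls; first by left.
right; have [X FX Xs] := ls s (mem_head _ _).
case: IH => [s' s'l|->|[Y FY Yl]]; first by apply: ls; rewrite in_cons s'l orbT.
  by exists X => // s'; rewrite mem_seq1 => /eqP ->.
have [XY|YX] := tot _ _ FX FY.
  exists Y => // s'; rewrite in_cons => /orP[/eqP ->|/Yl//]; exact: XY.
by exists X => // s'; rewrite in_cons => /orP[/eqP -> //|/Yl]; exact: YX.
Qed.

(** Domination is a property of finite subsets, hence is inherited by unions of
    chains. *)
Lemma maximal_tags : exists B, dominated_tags B /\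
  forall B', B `<` B' -> ~ dominated_tags B'.
Proof.
have [|B [PB Bmax]] := @Zorn_bigcup _ dominated_tags; last by exists B.
move=> FF FP tot F FU xs.
have [F0|[X FX FXs]] := chain_finite tot FU.
  by rewrite F0 big_nil; exact: kpos.
exact: FP FX _ FXs _.
Qed.

Let B := projT1 (cid maximal_tags).
Let Bdom : dominated_tags B. Proof. exact: (projT2 (cid maximal_tags)).1. Qed.
Let Bmax : forall B', B `<` B' -> ~ dominated_tags B'.
Proof. exact: (projT2 (cid maximal_tags)).2. Qed.

Let a (s : S) : I -> C := if `[< B s >] then s.2 else fun=> 0.

Let a_dom (F : {fset S}) xs : \sum_(s <- F) `|evalc (a s) xs| ^+ 2 <= quad k xs.
Proof.
rewrite (big_fsetID _ (fun s => `[< B s >])) /= addrC big_seq big1; last first.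
  move=> s; rewrite !inE /= => /andP[_ /negPf nB].
  rewrite /evalc /a nB big1 ?normr0 ?expr0n// => p _; exact: mulr0.
rewrite add0r; apply: le_trans (Bdom (F := [fset s in F | `[< B s >]]%fset) _ xs).
  rewrite big_seq [leRHS]big_seq; apply: ler_sum => s.
  by rewrite !inE /= => /andP[_ Bs]; rewrite /a Bs.
by move=> s; rewrite !inE /= => /andP[_ /asboolP].
Qed.

Let a_prod_sum i j : exists l, is_sum (fun s => a s i * Num.conj (a s j) : C) l.
Proof.
have a1 (F : {fset S}) i' : \sum_(s <- F) `|a s i'| ^+ 2 <= sqrtC (k i' i') ^+ 2.
  rewrite sqrtCK -quad1; apply: le_trans (a_dom F _).
  by under [leRHS]eq_bigr do rewrite /evalc big_seq1 /= mul1r.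
have [|l al _] := @abs_is_sum R S (cline R) (fun s => a s i * Num.conj (a s j))
  (sqrtC (k i i) * sqrtC (k j j)); last by exists l.
move=> F; under eq_bigr do rewrite normrM norm_conjC.
by apply: finite_cauchy_schwarz => //; rewrite sqrtC_ge0 pos_kernel_ge0.
Qed.

Let c i j : C := summability.sum (fun s => a s i * Num.conj (a s j) : C).

Let cP i j : is_sum (fun s => a s i * Num.conj (a s j) : C) (c i j).
Proof. by have [l al] := a_prod_sum i j; rewrite /c (sum_is_sum al). Qed.

Let r i j := k i j - c i j.

Let r_quad xs : is_sum (fun s => `|evalc (a s) xs| ^+ 2) (quad k xs - quad r xs).
Proof.
have -> : quad k xs - quad r xs =
    \sum_(p <- xs) \sum_(q <- xs) p.1 * Num.conj q.1 * c p.2 q.2.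
  rewrite -sumrB; apply: eq_bigr => p _; rewrite -sumrB; apply: eq_bigr => q _.
  by rewrite /r; ring.
apply: eq_is_sum (is_sum_bigsum xs (fun p => is_sum_bigsum xs (fun q =>
  is_sum_map (scale_bounded (p.1 * Num.conj q.1)) (cP p.2 q.2)))) => s /=.
rewrite normCK /evalc rmorph_sum mulr_suml; apply: eq_bigr => p _.
rewrite mulr_sumr; apply: eq_bigr => q _; rewrite rmorphM /=; ring.
Qed.

Let r_pos : pos_kernel r.
Proof.
move=> xs; rewrite -[quad r xs](subKr (quad k xs)) subr_ge0.
by apply: (is_sum_le _ (r_quad xs)) => [s|F]; [exact: exprn_ge0|exact: a_dom].
Qed.

(** If the remainder r were not zero at (i, i), the function
    b = r(., i) / sqrt (r i i) would satisfy |b|^2 <= r as forms, by the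
    Cauchy-Schwarz inequality of r.  Then all the tagged copies of b belong to
    the maximal set, which contradicts the convergence of the sum of the
    |a s i|^2. *)
Let r_diag i : r i i = 0.
Proof.
apply: contrapT => /eqP r0.
have rp : 0 < r i i by rewrite lt_def r0 pos_kernel_ge0.
have sp : 0 < sqrtC (r i i) by rewrite sqrtC_gt0.
pose b j := r j i / sqrtC (r i i).
have bii : `|b i| ^+ 2 = r i i.
  rewrite /b normrM normfV (gtr0_norm rp) (gtr0_norm sp) expr_div_n sqrtCK.
  by rewrite expr2 mulfK// gt_eqF.
have b_dom xs : `|evalc b xs| ^+ 2 <= quad r xs.
  have -> : evalc b xs = quadl r xs i / sqrtC (r i i).
    by rewrite /evalc /quadl mulr_suml; apply: eq_bigr => p _; rewrite mulrA.
  rewrite normrM normfV (gtr0_norm sp) expr_div_n sqrtCK ler_pdivrMr//.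
  exact: pos_kernel_cs.
have inB n : B (n, b).
  apply: contrapT => nB; apply: (Bmax (B' := B `|` [set (n, b)])).
    split=> [s Bs|]; first by left.
    move=> /(_ (n, b)) h; apply: nB; apply: h; by right.
  move=> F FB xs.
  pose F' := (F `\ (n, b))%fset.
  have F'B s : s \in F' -> B s by rewrite !inE => /andP[/eqP sn /FB[]].
  have F'le : \sum_(s <- F') `|evalc s.2 xs| ^+ 2 <= quad k xs - quad r xs.
    apply: le_trans (fsum_le_is_sum (fun s => exprn_ge0 2 (normr_ge0 _)) F' (r_quad xs)).
    rewrite big_seq [leRHS]big_seq; apply: ler_sum => s /F'B Bs.
    by rewrite /a; case: asboolP.
  have [nF|nF] := boolP ((n, b) \in F); last first.
    have FF' : F = F' by rewrite /F' mem_fsetD1.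
    rewrite FF'; apply: (le_trans F'le); rewrite gerBl; exact: r_pos.
  rewrite (big_fsetD1 (n, b))//= -[leRHS](subrK (quad r xs)) addrC.
  by apply: lerD => //; exact: b_dom.
have r2 : 0 < r i i / 2 by rewrite divr_gt0.
have a0 s : 0 <= `|evalc (a s) [:: (1, i)]| ^+ 2 by exact: exprn_ge0.
have [F FP] := nonneg_tail a0 (fun F => a_dom F [:: (1, i)]) r2.
(* A finite set misses some tagged copy of b. *)
have [n nF] : exists n, (n, b) \notin F.
  exists (\max_(s <- enum_fset F) s.1).+1; apply/negP => nF.
  have := @leq_bigmax_seq _ (enum_fset F) (fun=> true) (fun s : S => s.1) (_, b) nF isT.
  by rewrite ltnn.
have := FP [fset (n, b)]%fset; rewrite big_seq_fset1 /evalc big_seq1 /= mul1r.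
rewrite /a; case: asboolP => [_|/(_ (inB n))//]; rewrite /= bii => h.
have : r i i <= r i i / 2.
  by apply: h; apply/fdisjointP => s sF; rewrite inE; apply: contraNneq nF => <-.
by rewrite ler_pdivlMr// ger_pMr// (ler_nat _ 2 1).
Qed.

(** The remainder is positive with zero diagonal, hence zero. *)
Lemma kernel_decomposition : exists a : S -> I -> C,
  (forall s xs, `|evalc (a s) xs| ^+ 2 <= quad k xs) /\
  forall i j, is_sum (fun s => a s i * Num.conj (a s j) : C) (k i j).
Proof.
exists a; split=> [s xs|i j].
  by have := a_dom [fset s]%fset xs; rewrite big_seq_fset1.
have : r i j = 0.
  have := pos_kernel_cs r_pos [:: (1, i)] j; rewrite r_diag mulr0 /quadl big_seq1 /= mul1r.
  move=> h; have : `|r i j| ^+ 2 == 0 by rewrite eq_le h exprn_ge0.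
  by rewrite expf_eq0 /= normr_eq0 => /eqP.
by rewrite /r => /eqP; rewrite subr_eq0 => /eqP ->; exact: cP.
Qed.
End KernelDecomposition.

(** * Kraus families of CPTP maps *)

Section KrausExistence.
Context {R : realType} {H : hilbertType R}.
Local Notation C := (Cplx R).
Local Notation rank1 p w := (fun z : H => <|z, p|> *: w).
Variable Phi : (H -> H) -> H -> H.
Hypothesis Phi_lin : trace_class_linear Phi.
Hypothesis Phi_cp : completely_positive Phi.
Hypothesis Phi_tp : trace_preserving Phi.

(** The matrix coefficients of Phi at operators of rank one, as a kernel on pairs
    of vectors. *)
Definition choi_kernel (u v : H * H) : C := <|Phi (rank1 v.1 u.1) v.2, u.2|>.
Local Notation k := choi_kernel.

Let r1tc := @rank1_trace_class R H.

Lemma Phi_rank1_linear p w : linear (Phi (rank1 p w)).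
Proof. exact: (Phi_lin.1 _ (r1tc p w)).1.1. Qed.

(** The block operator (|x_i><x_j|) is positive, since its form at y is
    |sum_i <x_i, y_i>|^2. *)
Lemma choi_pos : pos_kernel k.
Proof.
move=> xs; pose n := size xs; pose t (i : 'I_n) := tnth (in_tuple xs) i.
have -> : quad k xs = \sum_(i < n) \sum_(j < n)
    <|Phi (rank1 (t j).2.1 (t i).2.1) (Num.conj (t j).1 *: (t j).2.2),
      Num.conj (t i).1 *: (t i).2.2|>.
  rewrite /quad big_tnth; apply: eq_bigr => i _; rewrite big_tnth.
  apply: eq_bigr => j _; rewrite (linZ (Phi_rank1_linear _ _)).
  by rewrite innerZl innerZr conjCK mulrA [X in X * _]mulrC.
apply: (@Phi_cp n (fun i j => rank1 (t j).2.1 (t i).2.1)) => [i j|y].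
  exact: r1tc.
have -> : \sum_(i < n) \sum_(j < n) <|<|y j, (t j).2.1|> *: (t i).2.1, y i|> =
    `|\sum_(i < n) <|(t i).2.1, y i|>| ^+ 2.
  rewrite normCK rmorph_sum mulr_suml; apply: eq_bigr => i _.
  by rewrite mulr_sumr; apply: eq_bigr => j _; rewrite innerZl [<|y j, _|>]innerC mulrC.
exact: exprn_ge0.
Qed.

Lemma choi_linl (c : C) x x' b v : k (c *: x + x', b) v = c * k (x, b) v + k (x', b) v.
Proof.
rewrite /k /=.
have -> : rank1 v.1 (c *: x + x') = fun z => c *: rank1 v.1 x z + rank1 v.1 x' z.
  by apply/funext => z; rewrite scalerDr !scalerA mulrC.
by rewrite Phi_lin.2// innerDl innerZl.
Qed.

Lemma choi_linr (c : C) x b b' v :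
  k (x, c *: b + b') v = Num.conj c * k (x, b) v + k (x, b') v.
Proof. by rewrite /k /= innerDr innerZr. Qed.

(** The combination u1 - c u2 - u3 is null for the form of the kernel, and a
    function dominated by the kernel vanishes on null combinations. *)
Lemma kernel_vanish (a : H * H -> C) (c d : C) u1 u2 u3 :
  (forall xs, `|evalc a xs| ^+ 2 <= quad k xs) ->
  (forall v, k u1 v = c * k u2 v + k u3 v) -> a u1 = c * a u2 + a u3.
Proof.
move=> ak kE; have := ak [:: (1, u1); (- c, u2); (- 1, u3)].
have -> : quad k [:: (1, u1); (- c, u2); (- 1, u3)] = 0.
  by rewrite /quad !big_cons !big_nil /= !kE; ring.
move=> h; have : `|evalc a [:: (1, u1); (- c, u2); (- 1, u3)]| ^+ 2 == 0.
  by rewrite eq_le h exprn_ge0.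
rewrite expf_eq0 /= normr_eq0 /evalc !big_cons big_nil /= => /eqP h0.
apply/eqP; rewrite -subr_eq0 -h0; apply/eqP; ring.
Qed.

(** Decompose the kernel into functions a_s.  Being dominated by it, they are
    linear in x, antilinear in b and bounded in b, so that
    a_s(x, b) = <A_s x, b> by Riesz.  Preservation of the trace gives
    sum_s |A_s x|^2 = tr Phi(|x><x|) = |x|^2. *)
Lemma kraus_exists : exists A : nat * (H * H -> C) -> H -> H, kraus_family Phi A.
Proof.
have [a [a_le ak]] := kernel_decomposition choi_pos.
have al s (c : C) x x' b : a s (c *: x + x', b) = c * a s (x, b) + a s (x', b).
  by apply: kernel_vanish (a_le s) _ => // v; exact: choi_linl.
have ar s (c : C) x b b' : a s (x, c *: b + b') = Num.conj c * a s (x, b) + a s (x, b').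
  by apply: kernel_vanish (a_le s) _ => // v; exact: choi_linr.
have [A AP] : exists A : nat * (H * H -> C) -> H -> H,
    forall s x b, <|A s x, b|> = a s (x, b).
  suff /choice[A AP] : forall sx : (nat * (H * H -> C)) * H, exists z,
      forall b, <|z, b|> = a sx.1 (sx.2, b).
    by exists (fun s x => A (s, x)) => s x b; exact: (AP (s, x)).
  move=> [s x] /=.
  have [z zP] : exists z, forall b, Num.conj (a s (x, b)) = <|b, z|>.
    have [|M0 M0_ge0 M0P] := @bounded_cst_ge0 C H H (Phi (rank1 x x)).
      exact: (Phi_lin.1 _ (r1tc x x)).1.
    apply: (@riesz R H _ (sqrtC M0)) => [c b b'|b].
      by rewrite ar rmorphD rmorphM /= conjCK.
    rewrite norm_conjC -(@ler_pXn2r _ 2) ?nnegrE ?mulr_ge0 ?sqrtC_ge0//.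
    rewrite exprMn sqrtCK.
    have := a_le s [:: (1, (x, b))]; rewrite quad1 /evalc big_seq1 /= mul1r.
    move=> /le_trans; apply; rewrite /k /= -[leLHS]ger0_norm; last first.
      by rewrite -[X in 0 <= X]/(k (x, b) (x, b)); exact: pos_kernel_ge0 choi_pos _.
    rewrite (le_trans (cauchy_schwarz _ _))// expr2 mulrA ler_wpM2r//.
  by exists z => b; rewrite innerC -zP conjCK.
have Alin s : linear (A s).
  by move=> c x y; apply: inner_ext => b; rewrite innerDl innerZl !AP al.
have weak x b d :
    is_sum (fun s => <|A s x, b|> * <|d, A s x|> : C) <|Phi (rank1 x x) d, b|>.
  apply: eq_is_sum (ak (x, b) (x, d)) => s.
  by rewrite (innerC d) !AP.
exists A; split=> //; split=> // x.
apply: (is_sum_exchange (u := fun s f => `|coef (A s x) f| ^+ 2)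
  (c := diag (Phi (rank1 x x)))) => [s f|s|f|].
- exact: exprn_ge0.
- exact: parseval_norm.
- rewrite /diag /coef; case: ifP => _; last first.
    by apply: eq_is_sum (is_sum_0 _) => s; rewrite normr0 expr0n.
  by apply: eq_is_sum (weak x f f) => s; rewrite normCK -innerC.
- have := trace_class_has_trace (Phi_lin.1 _ (r1tc x x)).
  by rewrite Phi_tp// (has_traceE (has_trace_rank1 x x)) -normsqE.
Qed.
End KrausExistence.

(** * Dilation of CPTP maps *)

Section PartialTrace.
Context {R : realType} {H Ht : hilbertType R} (HT : hilbert_tensor H Ht).

(** An operator r is determined by the traces of T r for T of rank one, as
    tr (|x><y| r) = <r x, y>. *)
Lemma ptrace2_eq (t : H -> H) (s : HT -> HT) : trace_class t ->
  (forall T : H -> H, bounded_operator T ->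
     trace (T \o t) = trace (op_tens HT T id \o s)) ->
  ptrace2 HT s = t.
Proof.
move=> ttc tE; rewrite /ptrace2; set D := [set t' | _].
have Dt : D t by [].
have [t'tc t'E] : D (xget (fun=> 0) D) := xgetI (fun=> 0) Dt.
move: (xget _ _) t'tc t'E => t' t'tc t'E.
apply/funext => x; apply: inner_ext => y.
have tr (r : H -> H) : trace_class r ->
    trace ((fun z => <|z, y|> *: x) \o r) = <|r x, y|>.
  move=> rtc; rewrite (adjointP rtc.1); apply: has_traceE.
  apply: eq_is_sum (has_trace_rank1 (adjoint r y) x) => e.
  by rewrite /diag /= (adjointP rtc.1).
have r1b : bounded_operator (fun z => <|z, y|> *: x) := (rank1_trace_class y x).1.
by rewrite -!tr// t'E// tE.
Qed.
End PartialTrace.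

Lemma is_sum_single (R : realType) (V : normedModType (Cplx R)) (I : choiceType)
    (f : I -> V) i0 : (forall i, i != i0 -> f i = 0) -> is_sum f (f i0).
Proof.
move=> f0 e e0; exists [fset i0]%fset => A; rewrite fsub1set => iA.
rewrite (big_fsetD1 i0)//= big_seq big1 ?addr0 ?subrr ?normr0 ?ltW// => i.
by rewrite !inE => /andP[/f0].
Qed.

Section TrivialKraus.
Context {R : realType} {H : hilbertType R} {S : choiceType} (s0 : S).

(** A Kraus family of the identity map.  On loops it has to be this one, whose
    isometry is x |-> x (x) eta, since it belongs to the element 0 of the group. *)
Definition trivial_kraus (s : S) : H -> H := if s == s0 then id else fun=> 0.

Lemma trivial_krausE s x : trivial_kraus s x = if s == s0 then x else 0.
Proof. by rewrite /trivial_kraus; case: ifP. Qed.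

Lemma trivial_kraus_isometric : isometric_family trivial_kraus.
Proof.
split=> [s a x y|x].
  by rewrite !trivial_krausE; case: ifP => // _; rewrite scaler0 addr0.
have := @is_sum_single R (Cplx R) S (fun s => `|trivial_kraus s x| ^+ 2) s0.
rewrite trivial_krausE eqxx; apply => s /negPf ss0.
by rewrite trivial_krausE ss0 normr0 expr0n.
Qed.

Lemma trivial_kraus_family (Phi : (H -> H) -> H -> H) :
  (forall s, trace_class s -> Phi s = s) -> kraus_family Phi trivial_kraus.
Proof.
move=> Phi1; split=> [|x a b]; first exact: trivial_kraus_isometric.
rewrite Phi1; last exact: rank1_trace_class.
have := @is_sum_single R (Cplx R) S
  (fun s => <|trivial_kraus s x, b|> * <|a, trivial_kraus s x|>) s0.
rewrite trivial_krausE eqxx innerZl mulrC; apply => s /negPf ss0.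
by rewrite trivial_krausE ss0 inner0l mul0r.
Qed.
End TrivialKraus.

(** The vector eta has its only coordinate at (0, s0), so that x (x) eta is D
    applied to x placed at the element 0 of the group.  Hence U_g maps it to the
    value at x of the isometry of the family of g. *)
Lemma cptp_dilation (R : realType) (Om : Type) (E : set (Om * Om))
    (H : hilbertType R) (Phi : Om -> Om -> (H -> H) -> H -> H) :
  (forall u v, E (u, v) -> trace_norm_contraction (Phi u v)) ->
  (forall u, E (u, u) -> forall s, trace_class s -> Phi u u s = s) ->
  (forall u v, E (u, v) -> cptp (Phi u v)) ->
  exists (Ht : hilbertType R) (HHt : hilbert_tensor H Ht)
         (U : Om -> Om -> HHt -> HHt) (omega : Ht -> Ht),
    [/\ divisible_system E U,
        forall u v, E (u, v) -> unitary (U u v),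
        pure_state omega &
        forall u v, E (u, v) -> forall s, trace_class s ->
          Phi u v s =
          ptrace2 HHt (U u v \o op_tens HHt s omega \o adjoint (U u v))].
Proof.
move=> contr Phi_id Phi_cptp.
pose S := (nat * (H * H -> Cplx R))%type.
pose s0 : S := (0%N, fun=> 0).
have /choice[AA AAP] : forall uv : Om * Om, exists A : S -> H -> H,
    E uv -> kraus_family (Phi uv.1 uv.2) A /\ (uv.1 = uv.2 -> A = trivial_kraus s0).
  move=> [u v] /=; have [Euv|nE] := pselect (E (u, v)); last by exists (fun=> id).
  have [uv|uv] := pselect (u = v).
    exists (trivial_kraus s0); split=> //; subst v.
    by apply: trivial_kraus_family; exact: Phi_id.
  have [Plin Pcp Ptp] := Phi_cptp _ _ Euv.
  by have [A AP] := kraus_exists Plin Pcp Ptp; exists A.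
have [|||psi [psi_iso psi0 psiE]] := @edge_extension Om E (S -> H -> H)
    (fun A => isometric_family A) (fun u v => AA (u, v)) (trivial_kraus s0).
- exact: trivial_kraus_isometric.
- by move=> u v Euv; have [[]] := AAP _ Euv.
- by move=> u Euu; have [_] := AAP _ Euu; apply.
pose G := (Om -> int)%type.
pose i0 : G * S := (0, s0).
pose eta : l2 (G * S)%type (cline R) := single i0 cline1.
pose HHt := @l2_tensor R (G * S)%type H.
pose U u v : HHt -> HHt := dil_unitary psi_iso (edge_elt u v).
have start x : single i0 x = dil psi_iso (single 0 x).
  apply: l2_ext => -[h s]; rewrite dilE !singleE /= xpair_eqE.
  have [->|h0] := eqVneq h 0; last by rewrite (lin0 ((psi_iso h).1 s)).
  by rewrite psi0 trivial_krausE.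
exists (l2 (G * S)%type (cline R)), HHt, U, (fun y => <|y, eta|> *: eta); split.
- split=> [u v _|u _|u v w _ _ _]; first exact: dil_unitary_bounded.
    by apply/funext => z; rewrite /U edge_eltxx dil_unitary0.
  by apply/funext => z; rewrite /U -(edge_eltD u v w) dil_unitaryD.
- by move=> u v _; exact: dil_unitaryP.
- by exists eta => //; rewrite norm_single; exact: normr1.
- move=> u v Euv s stc; symmetry.
  have [Plin _ Ptp] := Phi_cptp _ _ Euv.
  apply: ptrace2_eq; first exact: Plin.1.
  move=> T Tb; set g := edge_elt u v.
  have kraus : kraus_family (Phi u v) (psi g).
    by rewrite psiE//; have [] := AAP _ Euv.
  pose V x : HHt := dil psi_iso (single g x).
  pose V' (z : HHt) : H := dil_unitary psi_iso (- g) z i0.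
  have stepE : U u v \o op_tens HHt s (fun y => <|y, eta|> *: eta) \o adjoint (U u v)
      = V \o s \o V'.
    apply/funext => z; rewrite /= op_tens_state; last exact: stc.1.
    by rewrite start /U dil_unitary_dil add0r adjoint_dil_unitaryE.
  rewrite stepE (op_tens_id Tb).
  apply: (@kraus_trace R H S (Phi u v) (psi g) Plin (contr _ _ Euv) Ptp kraus HHt
    V V' T (l2_map Tb) Tb _ _ _ _ _ s stc).
  + split; first exact: l2_map_linear.
    by have [M M0 TM] := bounded_cst_ge0 Tb; exists M; exact: l2_map_le.
  + move=> a x y; rewrite /V -dil_linear; congr (dil _ _); apply: l2_ext => h.
    rewrite bfamD bfamZ !singleE; case: ifP => // _.
    by rewrite scaler0 addr0.
  + by move=> x; rewrite norm_dil_single.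
  + move=> z x; rewrite -inner_single inner_dil_unitary opprK start.
    by rewrite dil_unitary_dil add0r.
  + move=> x.
    have VE j : V x j = psi j.1 j.2 (if j.1 == g then x else 0) by [].
    have kinj : injective (fun t : S => (g, t) : G * S) by move=> t t' [].
    have off (j : G * S) : (forall t, j <> (g, t)) -> <|l2_map Tb (V x) j, V x j|> = 0.
      case: j => h t nj; rewrite VE /= ifN; last first.
        by apply/eqP => hg; apply: (nj t); rewrite hg.
      by rewrite (lin0 ((psi_iso h).1 t)) inner0r.
    apply: eq_is_sum (reindex_is_sum kinj off (l2_is_sum_inner _ _)) => t.
    by rewrite l2_mapE VE eqxx.
Qed.

Unset Implicit Arguments.
Set Strict Implicit.

Theorem theorem1p7 (R : realType) (Om : Type) (E : set (Om * Om))
    (Om_neq0 : [set: Om] !=set0) (E_neq0 : E !=set0) :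
  (* (a) *)
  (forall K : numFieldType, banach_scalars R K ->
   forall (X : completeNormedModType K) (phi : Om -> Om -> X -> X),
     (forall u v, E (u, v) -> linear_contraction (phi u v)) ->
     identity_axiom E phi ->
     exists (Xt : completeNormedModType K) (U : Om -> Om -> Xt -> Xt)
            (j : Xt -> X) (r : X -> Xt),
       [/\ divisible_system E U,
           forall u v, E (u, v) -> linear_isometry (U u v) /\ surjective (U u v),
           linear_contraction j /\ surjective j,
           linear_isometry r /\ j \o r = id &
           forall u v, E (u, v) -> j \o U u v \o r = phi u v]) /\
  (* (b) *)
  (forall (A : cstarAlgType R) (Phi : Om -> Om -> A -> A),
     (forall u v, E (u, v) -> linear_contraction (Phi u v)) ->
     identity_axiom E Phi ->
     (forall u v, E (u, v) -> positive_map (Phi u v) /\ unital_map (Phi u v)) ->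
     exists (At : cstarAlgType R) (U : Om -> Om -> At -> At)
            (j : At -> A) (r : A -> At),
       (cstar_commutative A -> cstar_commutative At) /\
       [/\ divisible_system E U,
           forall u v, E (u, v) -> star_automorphism (U u v),
           unital_star_hom j /\ surjective j,
           [/\ linear_isometry r, positive_map r, unital_map r & j \o r = id] &
           forall u v, E (u, v) -> j \o U u v \o r = Phi u v]) /\
  (* (c) *)
  (forall (H : hilbertType R) (Phi : Om -> Om -> (H -> H) -> H -> H),
     (forall u v, E (u, v) -> trace_norm_contraction (Phi u v)) ->
     (forall u, E (u, u) -> forall s, trace_class s -> Phi u u s = s) ->
     (forall u v, E (u, v) -> cptp (Phi u v)) ->
     exists (Ht : hilbertType R) (HHt : hilbert_tensor H Ht)
            (U : Om -> Om -> HHt -> HHt) (omega : Ht -> Ht),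
       [/\ divisible_system E U,
           forall u v, E (u, v) -> unitary (U u v),
           pure_state omega &
           forall u v, E (u, v) -> forall s, trace_class s ->
             Phi u v s =
             ptrace2 HHt (U u v \o op_tens HHt s omega \o adjoint (U u v))]).
Proof.
split; [|split].
- by move=> K HK X phi; exact: (banach_dilation HK).
- by move=> A Phi; exact: cstar_dilation.
- by move=> H Phi; exact: cptp_dilation.
Qed.
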